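(* Let $d\in\mathbb{N}$ with $d\geq 4$ and let $(c_{n})_{n\in\mathbb{N}}$ be a sequence of positive real numbers with $c_{n}\geq \left(1+\frac{2^{d+5}}{\log n}\right)^{1/d}$ for every $n\geq 2$. For each $n\in\mathbb{N}$ define $F_{n}\colon \binom{\mathbb{Z}^{d}}{n^{d}}\to(0,\infty)$ by $$F_{n}(S)=\min\{\operatorname{Lip}(f)\colon f\colon S\to\{1,\ldots,n\}^{d}\text{ surjective}\}.$$ Consider the probability space $\mathcal{G}_{(c_{n})}=\prod_{n=1}^{\infty}\binom{\{1,\ldots,\lfloor c_{n} n\rfloor\}^{d}}{n^{d}}$ equipped with the product of the uniform probability measures on its (finite) factors. Then a random sequence $(S_{n})\in\mathcal{G}_{(c_{n})}$ satisfies $$\mathbb{P}\left[\limsup_{n\to\infty}F_{n}(S_{n})(\log n)^{-1}<\infty\right]=1.$$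
   Context: $\log$ denotes the logarithm to base $2$. For a set $A$ and $k\in\mathbb{N}$, $\binom{A}{k}$ is the set of all $k$-element subsets of $A$. Lipschitz constants are taken with respect to the Euclidean metric. For a finite set $X$ the uniform probability measure is $\mathbb{P}_X(A)=|A|/|X|$ for $A\subseteq X$; on a countable product of finite sets one takes the product of these uniform measures. *)

(* Defs.v *)
From HB Require Import structures.
From mathcomp Require Import all_boot all_order all_algebra.
From mathcomp Require Import all_classical all_reals.
From mathcomp Require Import topology normedtype sequences exp measure.
Set Implicit Arguments. Unset Strict Implicit. Unset Printing Implicit Defensive.
Import Order.TTheory GRing.Theory Num.Theory.
Local Open Scope classical_set_scope.
Local Open Scope ring_scope.

Section Defs.
Variable R : realType.

Definition log2 (x : R) : R := ln x / ln 2.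

(* The grid {1,...,m}^d: a point p is a function 'I_d -> 'I_m, and
   coordinate i of p is the integer (p i) + 1. *)
Definition grid (m d : nat) := {ffun 'I_d -> 'I_m}.

Definition emb (m d : nat) (p : grid m d) : 'I_d -> R := fun i => (p i)%:R + 1.

Definition edist (d : nat) (x y : 'I_d -> R) : R :=
  Num.sqrt (\sum_(i < d) (x i - y i) ^+ 2).

Definition LipOn (m n d : nat) (S : {set grid m d}) (f : grid m d -> grid n d) : R :=
  \big[Num.max/0]_(x in S) \big[Num.max/0]_(y in S | y != x)
     (edist (emb (f x)) (emb (f y)) / edist (emb x) (emb y)).

Definition Fn (m n d : nat) (S : {set grid m d}) : R :=
  inf [set LipOn S f | f in [set f : grid m d -> grid n d | (f @: S)%SET = finset.setTfor (grid n d)]].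

Definition Kc (c : nat -> R) (n : nat) : nat := Num.truncn (c n * n%:R).

Definition Fact (c : nat -> R) (d n : nat) :=
  {A : {set grid (Kc c n) d} | #|A| == (n ^ d)%N}.

(* the product space; the factor at n = 0 is a one-point space (only the
   empty subset of the empty grid), so this is isomorphic to prod_{n>=1} *)
Definition Omega (c : nat -> R) (d : nat) := forall n : nat, Fact c d n.

Definition cylinder (c : nat -> R) (d N : nat) (s : forall n : 'I_N, Fact c d n)
  : set (Omega c d) := [set w | forall n : 'I_N, w n = s n].

Definition cylinders (c : nat -> R) (d : nat) : set (set (Omega c d)) :=
  [set A | exists N (s : forall n : 'I_N, Fact c d n), A = cylinder s].

Definition product_uniform_prob (c : nat -> R) (d : nat) (P : set (Omega c d) -> R) :=
  [/\ forall A, <<s @cylinders c d >> A -> 0 <= P A,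
      P setT = 1,
      (forall F : nat -> set (Omega c d),
          (forall i, <<s @cylinders c d >> (F i)) -> trivIset setT F ->
          (fun k : nat => \sum_(0 <= i < k) P (F i)) @ \oo --> (P (\bigcup_i F i) : R^o))
    & forall N (s : forall n : 'I_N, Fact c d n),
        P (cylinder s) = \prod_(n < N) (#|{: Fact c d n}|%:R)^-1 ].

Definition Fw (c : nat -> R) (d : nat) (w : Omega c d) (n : nat) : R :=
  Fn n (val (w n)).

End Defs.

(* Main.v *)
(* Rescaling sends {1..K}^d onto {1..n}^d; cut both grids into 2^p cells per
   axis, of side s = n/2^p of order log n on the target side.  If S matches
   bijectively onto the target so that matched points lie in equal or touching
   cells, the matching moves rescaled points by at most 2s, hence is O(log n)-Lipschitz.
   By Hall's theorem such a matching exists as soon as, for every set U of cells,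
   |S in U| - |target in U| is at most the number of target points in the outer
   boundary of U.  Summation by parts over dyadic scales bounds the left side by
   the size of the boundary of U times the sum over scales of (discrepancy of a
   box of side t) / t^(d-1).  The deterministic (rounding) discrepancy is
   O(t^(d-1)), and a Chernoff bound for the hypergeometric law with parameter 1/t
   gives the same order for the random one, outside an event of probability at
   most exp(-t^(d-2)) <= exp(-s^2) since d >= 4.  Each of the at most log n
   scales thus costs O(s^(d-1)), against s^d available in a boundary cell, which
   is why s of order log n is enough.  Borel-Cantelli concludes. *)
Require Import Defs.
From HB Require Import structures.
From mathcomp Require Import all_boot all_order all_algebra.
From mathcomp Require Import ring lra zify.
Set Implicit Arguments. Unset Strict Implicit. Unset Printing Implicit Defensive.
Import Order.TTheory GRing.Theory Num.Theory.

(** * Hall's marriage theorem *)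

(** Induction on [#|S|]. A tight proper subset is matched inside its neighbourhood and the rest of
    [S] outside it; if there is none, any point may take any of its neighbours. [y0] gives [f] a
    value when [S] is empty. *)
Lemma hall_marriage (X Y : finType) (y0 : Y) (E : X -> {set Y}) (S : {set X}) :
  (forall A : {set X}, A \subset S -> #|A| <= #|\bigcup_(x in A) E x|) ->
  exists2 f : X -> Y, {in S &, injective f} & forall x, x \in S -> f x \in E x.
Proof.
have [m] := ubnP #|S|; elim: m => // m IHm in E S *; rewrite ltnS => leSm hallS.
have [S0|[x0 Sx0]] := set_0Vmem S.
  by exists (fun=> y0) => [x y|x]; rewrite S0 inE.
pose tight (A : {set X}) :=
  [&& A \proper S, A != set0 & #|\bigcup_(x in A) E x| <= #|A|].
have [A /and3P[pAS A0 tA]|loose] := pickP tight.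
  have sAS := proper_sub pAS; have ltAS := proper_card pAS.
  have [||f injf fE] := IHm E A; first exact: leq_trans ltAS leSm.
    by move=> B sBA; apply: hallS; apply: subset_trans sBA sAS.
  pose N := \bigcup_(x in A) E x.
  have [||g injg gE] := IHm (fun x => E x :\: N) (S :\: A).
  - by rewrite cardsD (setIidPr sAS); move: A0; rewrite -card_gt0; lia.
  - move=> B; rewrite subsetD => /andP[sBS dBA].
    (* Hall's condition for [A :|: B] minus the count of the tight set [A] is the condition for [B]
       once [N] is removed. *)
    have := hallS (A :|: B); rewrite subUset sAS sBS => /(_ isT).
    rewrite cardsU disjoint_setI0 1?disjoint_sym // cards0 subn0 bigcup_setU.
    rewrite -/N; set M := \bigcup_(x in B) E x.
    have -> : \bigcup_(x in B) (E x :\: N) = M :\: N.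
      apply/setP=> y; rewrite inE; apply/bigcupP/andP.
        by case=> x Bx /setDP[Exy Ny]; split=> //; apply/bigcupP; exists x.
      by case=> Ny /bigcupP[x Bx Exy]; exists x => //; rewrite inE Ny.
    rewrite -(cardsID N (N :|: M)) setUC setIC setKU setDUl setDv setU0.
    by move: tA; rewrite -/N; lia.
  exists (fun x => if x \in A then f x else g x) => [x y Sx Sy|x Sx].
    have gN z : z \in S -> z \notin A -> g z \notin N.
      by move=> Sz Az; have := gE z; rewrite !inE Sz Az => /(_ isT) /andP[].
    have fN z : z \in A -> f z \in N by move=> Az; apply/bigcupP; exists z => //; exact: fE.
    case: ifP => Ax; case: ifP => Ay; first exact: injf.
    - by move=> e; have := gN y Sy; rewrite Ay -e fN // => /(_ isT).
    - by move=> e; have := gN x Sx; rewrite Ax e fN // => /(_ isT).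
    - by apply: injg; rewrite inE ?Ax ?Ay.
  case: ifP => Ax; first exact: fE.
  by have := gE x; rewrite !inE Sx Ax => /(_ isT) /andP[].
have /card_gt0P[y Ey] : 0 < #|E x0|.
  by have := hallS [set x0]; rewrite big_set1 cards1 sub1set; exact.
have [||g injg gE] := IHm (fun x => E x :\ y) (S :\ x0).
- by have := cardsD1 x0 S; rewrite Sx0; lia.
- move=> A sA; have [->|A0] := eqVneq A set0; first by rewrite cards0.
  have -> : \bigcup_(x in A) (E x :\ y) = (\bigcup_(x in A) E x) :\ y.
    apply/setP=> z; rewrite inE; apply/bigcupP/andP.
      by case=> x Bx /setDP[Exy Ny]; split=> //; apply/bigcupP; exists x.
    by case=> Ny /bigcupP[x Bx Exy]; exists x => //; rewrite inE Ny.
  (* [A] is not tight, so it has a neighbour to spare and can lose [y]. *)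
  have := loose A; rewrite /tight A0 andTb; set M := \bigcup_(x in A) E x.
  rewrite (_ : A \proper S); last by apply: sub_proper_trans sA (properD1 Sx0).
  by have := cardsD1 y M; case: (y \in M); lia.
exists (fun x => if x == x0 then y else g x) => [a b Sa Sb|x Sx].
  have gy z : z \in S -> z != x0 -> g z != y.
    by move=> Sz z0; have := gE z; rewrite !inE Sz z0 => /(_ isT) /andP[].
  case: (eqVneq a x0) => [->|a0]; case: (eqVneq b x0) => [->|b0] //.
  - by move=> e; have := gy b Sb b0; rewrite -e eqxx.
  - by move=> e; have := gy a Sa a0; rewrite e eqxx.
  - by apply: injg; rewrite !inE ?a0 ?b0.
case: eqVneq => [->//|x_0].
by have := gE x; rewrite !inE Sx x_0 => /(_ isT) /andP[].
Qed.

Local Open Scope ring_scope.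

(** * Moment generating function of the hypergeometric law *)

Lemma sum_subset_expr (R : comNzRingType) (X : finType) (B : {set X}) (y : R) :
  \sum_(A : {set X} | A \subset B) y ^+ #|A| = (1 + y) ^+ #|B|.
Proof.
rewrite addrC -prodr_const [RHS]big_mkcond /=.
have -> : \prod_x (if x \in B then y + 1 else 1) =
    \prod_x ((if x \in B then y else 0) + 1).
  by apply: eq_bigr => x _; case: ifP => //; rewrite add0r.
rewrite bigA_distr big_mkcond /=; apply: eq_bigr => A _.
case: ifPn => [sAB|/subsetPn[x Ax Bx]].
  rewrite -prodr_const big_mkcond; apply: eq_bigr => x _.
  by case: ifP => // /(subsetP sAB) ->.
by rewrite (bigD1 x) //= Ax (negbTE Bx) mul0r.
Qed.

Lemma card_draws_supset (X : finType) (A : {set X}) (N : nat) :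
  (#|A| <= N)%N ->
  #|[set S : {set X} | (A \subset S) && (#|S| == N)]| = 'C(#|X| - #|A|, N - #|A|)%N.
Proof.
move=> leAN; rewrite -[(#|X| - _)%N](_ : #|~: A| = _); last by rewrite cardsCs setCK.
rewrite -cards_draws -(card_in_imset (f := fun S => S :\: A)); last first.
  move=> S S'; rewrite !inE => /andP[sAS _] /andP[sAS' _] e.
  by rewrite -(setID S A) -(setID S' A) e (setIidPr sAS) (setIidPr sAS').
apply: eq_card => S; apply/imsetP/idP => [[S']|].
  rewrite !inE => /andP[sAS /eqP <-] ->.
  by rewrite setDE subsetIr -setDE cardsD (setIidPr sAS) eqxx.
rewrite inE => /andP[sSA /eqP cS].
have d : [disjoint S & A] by rewrite disjoints_subset.
exists (S :|: A); last by rewrite setDUl setDv setU0 (setDidPl d).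
by rewrite inE subsetUr cardsU disjoint_setI0 // cards0 cS; lia.
Qed.

(** Drawing without replacement, each new factor [(N - a) / (T - a)] is at most [N / T]. This bounds
    by [(N / T) ^ a] the probability that a uniform [N]-subset contains [a] given points. *)
Lemma bin_subn_le (T N a : nat) : (a <= N)%N -> (N <= T)%N ->
  ('C(T - a, N - a) * T ^ a <= 'C(T, N) * N ^ a)%N.
Proof.
elim: a => [|a IH] leaN leNT; first by rewrite !subn0 !expn0.
have {IH} := IH (ltnW leaN) leNT.
have := mul_bin_diag (T - a) (N - a).-1.
rewrite prednK ?subn_gt0 // !subnS => e.
set U := 'C((T - a).-1, (N - a).-1) in e *; set V := 'C(T - a, N - a) in e *.
move=> h; rewrite !expnS.
have le2 : ((N - a) * T <= N * (T - a))%N.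
  by rewrite mulnBl mulnBr; have := leq_mul (leqnn a) leNT; lia.
rewrite -(leq_pmul2l (m := T - a)); last by lia.
rewrite mulnA e mulnACA.
apply: leq_trans (leq_mul le2 h) _; apply/eq_leq; ring.
Qed.

(* Expanding [z ^ #|S :&: B|] over the subsets [A] of [S :&: B] reduces this to
   [P(A \subset S) <= (N / #|X|) ^ #|A|]. *)
Lemma hypergeometric_mgf (R : realFieldType) (X : finType) (N : nat) (B : {set X})
    (z : R) : (N <= #|X|)%N -> 1 <= z ->
  \sum_(S : {set X} | #|S| == N) z ^+ #|S :&: B|
    <= 'C(#|X|, N)%:R * (1 + (z - 1) * (N%:R / #|X|%:R)) ^+ #|B|.
Proof.
move=> leNX z1; set r := N%:R / #|X|%:R.
have y0 : 0 <= z - 1 by rewrite subr_ge0.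
have -> : \sum_(S : {set X} | #|S| == N) z ^+ #|S :&: B| =
    \sum_(S : {set X} | #|S| == N) \sum_(A : {set X} | A \subset S :&: B) (z - 1) ^+ #|A|.
  by apply: eq_bigr => S _; rewrite sum_subset_expr addrC subrK.
rewrite (exchange_big_dep predT) //= -sum_subset_expr mulr_sumr.
rewrite [leLHS](bigID (fun A : {set X} => A \subset B)) /= [X in _ + X]big1 => [|A sAB]; last first.
  by rewrite big_pred0 // => S; rewrite subsetI (negbTE sAB) !andbF.
rewrite addr0; apply: ler_sum => A sAB.
rewrite sumr_const -[_ *+ _]mulr_natl exprMn [_ * (_ ^+ _ * _)]mulrCA mulrC.
apply: ler_wpM2l; first exact: exprn_ge0.
have -> : #|[pred S : {set X} | (#|S| == N) && (A \subset S :&: B)]| =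
   #|[set S : {set X} | (A \subset S) && (#|S| == N)]|.
  by apply: eq_card => S; rewrite !inE subsetI sAB andbT andbC.
have [leAN|ltNA] := leqP #|A| N; last first.
  rewrite (_ : [set _ | _] = set0) ?cards0 ?mulr_ge0 ?exprn_ge0 ?divr_ge0 //.
  apply/setP=> S; rewrite !inE; apply/negbTE/negP=> /andP[/subset_leq_card h /eqP e].
  by rewrite e leqNgt ltNA in h.
rewrite card_draws_supset // /r expr_div_n mulrA.
have [X0|X0] := posnP #|X|.
  have A0 : #|A| = 0%N by apply/eqP; rewrite -leqn0 -X0 max_card.
  by rewrite A0 !expr0 divr1 mulr1 !subn0.
by rewrite ler_pdivlMr ?exprn_gt0 ?ltr0n // -!natrX -!natrM ler_nat bin_subn_le.
Qed.

(** * Multiscale summation by parts on dyadic cells *)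

(* Clamped at the boundary of the grid, where [shift i b = b]. *)
Definition shift (m d : nat) (i : 'I_d) (b : grid m d) : grid m d :=
  [ffun j => if j == i then insubd (b i) (b i).+1 else b j].

Lemma shift_eq (m d : nat) (i : 'I_d) (b : grid m d) :
  (shift i b == b) = ~~ ((b i).+1 < m)%N.
Proof.
apply/eqP/idP => [/ffunP /(_ i)|h].
  rewrite ffunE eqxx => e; apply/negP => lt.
  by have := congr1 val e; rewrite /= insubdK // => /esym /eqP; rewrite ltn_eqF.
apply/ffunP => j; rewrite ffunE; case: eqP => [->|//].
by rewrite /insubd insubN.
Qed.

Lemma shiftE (m d : nat) (i : 'I_d) (b : grid m d) j : ((b i).+1 < m)%N ->
  shift i b j = (b j + (j == i))%N :> nat.
Proof.
move=> h; rewrite ffunE; case: eqP => [->|_]; last by rewrite addn0.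
by rewrite insubdK // addn1.
Qed.

(** [shift i] is injective on the cells it moves, so the left side visits each cell at most once. *)
Lemma sum_shift_le (R : numDomainType) (m d : nat) (i : 'I_d) (h : grid m d -> R) :
  (forall b, 0 <= h b) -> \sum_(b | shift i b != b) h (shift i b) <= \sum_b h b.
Proof.
move=> h0; rewrite -(big_imset h (h := shift i)) /=.
  by rewrite [leRHS](bigID [in shift i @: [pred b | shift i b != b]]) lerDl sumr_ge0.
move=> b b'; rewrite !unfold_in !shift_eq !negbK => lb lb' e.
apply/ffunP => j; apply/val_inj/eqP.
have := congr1 (fun f : grid m d => nat_of_ord (f j)) e.
by rewrite !shiftE // => /eqP; rewrite eqn_add2r.
Qed.

(** The [l^1] norm of the discrete gradient; clamping makes the differences across the upper faces
    of the grid vanish. *)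
Definition total_variation (R : numDomainType) (m d : nat) (v : grid m d -> R) : R :=
  \sum_(i < d) \sum_b `|v b - v (shift i b)|.

Lemma half_lt (q : nat) (x : 'I_(2 ^ q.+1)) : (x./2 < 2 ^ q)%N.
Proof. by case: x => x /=; rewrite expnS; lia. Qed.

Lemma child_lt (q : nat) (x : 'I_(2 ^ q)) (e : bool) : (e + x.*2 < 2 ^ q.+1)%N.
Proof. by have := ltn_ord x; rewrite expnS; case: e; lia. Qed.

Definition parent (q d : nat) (b : grid (2 ^ q.+1) d) : grid (2 ^ q) d :=
  [ffun i => Ordinal (half_lt (b i))].

Definition child (q d : nat) (c : grid (2 ^ q) d) (e : {ffun 'I_d -> bool}) :
  grid (2 ^ q.+1) d := [ffun i => Ordinal (child_lt (c i) (e i))].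

Lemma childE (q d : nat) (c : grid (2 ^ q) d) e i :
  child c e i = (e i + (c i).*2)%N :> nat.
Proof. by rewrite ffunE. Qed.

Lemma sum_child (R : nmodType) (q d : nat) (F : grid (2 ^ q.+1) d -> R) :
  \sum_b F b = \sum_c \sum_e F (child c e).
Proof.
rewrite pair_bigA /= (reindex (fun ce => child ce.1 ce.2)) //.
exists (fun b => (parent b, [ffun i => odd (b i)])) => [[c e] _|b _] /=.
  congr pair; apply/ffunP => i; rewrite !ffunE /=; last by case: (e i); rewrite /= odd_double.
  by apply: val_inj; rewrite /= half_bit_double.
by apply/ffunP => i; apply: val_inj; rewrite /= childE !ffunE /= odd_double_half.
Qed.

Definition raise (d : nat) (i : 'I_d) (e : {ffun 'I_d -> bool}) : {ffun 'I_d -> bool} :=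
  [ffun j => (j == i) || e j].

(** Join both corners to the all-[true] corner by raising one coordinate at a time. Each path uses
    at most one edge per direction, and the two paths give the factor 2. *)
Lemma cube_oscillation (R : numDomainType) (d : nat) (w : {ffun 'I_d -> bool} -> R) e e' :
  `|w e - w e'| <= 2 * \sum_(i < d) \sum_f `|w f - w (raise i f)|.
Proof.
suff to_top f : `|w f - w [ffun=> true]| <= \sum_(i < d) \sum_f `|w f - w (raise i f)|.
  by rewrite mulr_natl mulr2n (le_trans (ler_distD (w [ffun=> true]) _ _)) // lerD // distrC.
(* [h k] is the point of the path where the first [k] coordinates have been raised. *)
pose h k : {ffun 'I_d -> bool} := [ffun i : 'I_d => (i < k)%N || f i].
have -> : f = h 0%N by apply/ffunP => i; rewrite ffunE.
have -> : [ffun=> true] = h d by apply/ffunP => i; rewrite !ffunE ltn_ord.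
rewrite distrC -(telescope_sumr (fun k => w (h k))) // big_mkord.
apply: le_trans (ler_norm_sum _ _ _) _; apply: ler_sum => i _.
have -> : h i.+1 = raise i (h i).
  by apply/ffunP => j; rewrite !ffunE ltnS leq_eqVlt orbA.
by rewrite distrC (bigD1 (h i)) //= lerDl sumr_ge0.
Qed.

Definition average (R : numFieldType) (q d : nat) (v : grid (2 ^ q.+1) d -> R)
  (c : grid (2 ^ q) d) : R := (\sum_e v (child c e)) / 2 ^+ d.

Lemma card_cube (d : nat) : #|{ffun 'I_d -> bool}| = (2 ^ d)%N.
Proof. by rewrite card_ffun card_bool card_ord. Qed.

(** An [l^1] Poincare inequality on each coarse cell. The constant is the 2 of [cube_oscillation]
    times the [2 ^ d] children. *)
Lemma sum_dist_average (R : numFieldType) (q d : nat) (v : grid (2 ^ q.+1) d -> R) :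
  \sum_c \sum_e `|v (child c e) - average v c| <= 2 ^+ d.+1 * total_variation v.
Proof.
pose E c : R := \sum_(i < d) \sum_f `|v (child c f) - v (child c (raise i f))|.
have h2 : (2 ^+ d : R) != 0 by rewrite expf_neq0 // pnatr_eq0.
have dist c e : `|v (child c e) - average v c| <= 2 * E c.
  have -> : v (child c e) - average v c =
     (\sum_f (v (child c e) - v (child c f))) / 2 ^+ d.
    rewrite sumrB sumr_const card_cube mulrBl -[_ *+ (2 ^ d)%N]mulr_natr natrX mulfK //.
  rewrite normrM normfV (ger0_norm (exprn_ge0 _ _)) // ler_pdivrMr ?exprn_gt0 //.
  apply: le_trans (ler_norm_sum _ _ _) _.
  rewrite mulrC -natrX -card_cube [_%:R * (_ * _)]mulr_natl -sumr_const; apply: ler_sum => f _.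
  exact: (cube_oscillation (fun e => v (child c e))).
apply: (@le_trans _ _ (\sum_(c : grid (2 ^ q) d) \sum_(e : {ffun 'I_d -> bool}) 2 * E c)).
  by apply: ler_sum => c _; apply: ler_sum.
under eq_bigr => c _ do rewrite sumr_const card_cube -[_ *+ (2 ^ d)%N]mulr_natl natrX mulrA -exprSr.
rewrite -mulr_sumr ler_wpM2l ?exprn_ge0 // /E exchange_big /=; apply: ler_sum => i _.
rewrite sum_child; apply: ler_sum => c _; apply: ler_sum => e _.
(* A coordinate that is already [true] gives no edge; raising any other one is a unit shift of the
   fine grid. *)
case ei: (e i).
  suff -> : raise i e = e by rewrite subrr normr0.
  by apply/ffunP => j; rewrite ffunE; case: eqP => [->|//]; rewrite ei.
suff -> : child c (raise i e) = shift i (child c e) by [].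
apply/ffunP => j; apply: val_inj; rewrite /= shiftE.
  rewrite !childE ffunE; case: eqP => [->|]; last by rewrite addn0.
  by rewrite ei addn1.
by rewrite childE ei; have := child_lt (c i) true.
Qed.

(** Shifting a coarse cell shifts each of its children twice, hence the factor 2; the division by
    [2 ^ d] is that of the average. *)
Lemma total_variation_average (R : numFieldType) (q d : nat) (v : grid (2 ^ q.+1) d -> R) :
  total_variation (average v) <= 2 / 2 ^+ d * total_variation v.
Proof.
rewrite /total_variation mulr_sumr; apply: ler_sum => i _.
pose h b := `|v b - v (shift i b)|.
have hp b : 0 <= h b by exact: normr_ge0.
have d0 : (0 : R) < 2 ^+ d by rewrite exprn_gt0.
have step c : `|average v c - average v (shift i c)| * 2 ^+ d <=
    \sum_e (h (child c e) +
            if shift i (child c e) != child c e then h (shift i (child c e)) else 0).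
  have h0 b : 0 <= if shift i b != b then h (shift i b) else 0.
    by case: ifP.
  have [e|lt] := eqVneq (shift i c) c.
    by rewrite e subrr normr0 mul0r sumr_ge0 // => b _; rewrite addr_ge0.
  move: lt; rewrite shift_eq negbK => lt.
  rewrite -[X in _ * X]ger0_norm ?(ltW d0) // -normrM -mulrBl mulfVK ?gt_eqF // -sumrB.
  apply: le_trans (ler_norm_sum _ _ _) _; apply: ler_sum => e _.
  have lt1 : ((child c e i).+1 < 2 ^ q.+1)%N.
    by rewrite childE expnS; move: lt; case: (e i); lia.
  have lt2 : ((shift i (child c e) i).+1 < 2 ^ q.+1)%N.
    by rewrite shiftE // childE eqxx expnS; move: lt; case: (e i); lia.
  have -> : child (shift i c) e = shift i (shift i (child c e)).
    apply/ffunP => j; apply: val_inj; rewrite /= shiftE // shiftE // !childE shiftE //.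
    by case: (j == i); lia.
  by rewrite shift_eq lt1 /= ler_distD.
rewrite mulrAC ler_pdivlMr // mulr_suml.
apply: le_trans (ler_sum _ (fun c _ => step c)) _.
rewrite -(sum_child (fun b => h b + if shift i b != b then h (shift i b) else 0)).
rewrite big_split /= mulr_natl mulr2n lerD2l -big_mkcond.
exact: sum_shift_le.
Qed.

(* Split [v] into its average over the children
   of each cell and the remainder, and recurse on the averages. *)
Lemma multiscale_bound (R : numFieldType) (d p : nat)
    (G : forall q, grid (2 ^ q) d -> R) (D : nat -> R) :
  (forall q c, G q c = \sum_e G q.+1 (child c e)) ->
  (forall b, G 0%N b = 0) ->
  (forall q b, (q <= p)%N -> `|G q b| <= D q) ->
  (forall q, D q * 2 = D q.+1 * 2 ^+ d) ->
  forall v : grid (2 ^ p) d -> R,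
  `|\sum_b G p b * v b| <= p%:R * 2 ^+ d.+1 * D p * total_variation v.
Proof.
move=> Gsum G0 GD Dq.
suff aux q : (q <= p)%N -> forall v : grid (2 ^ q) d -> R,
    `|\sum_b G q b * v b| <= q%:R * 2 ^+ d.+1 * D q * total_variation v by exact: aux.
elim: q => [_ v|q IHq ltqp v].
  rewrite big1 => [|b _]; last by rewrite G0 mul0r.
  by rewrite normr0 !mul0r.
have -> : \sum_b G q.+1 b * v b = \sum_c \sum_e G q.+1 (child c e) * (v (child c e) - average v c)
    + \sum_c G q c * average v c.
  rewrite sum_child -big_split /=; apply: eq_bigr => c _.
  rewrite Gsum mulr_suml -big_split /=; apply: eq_bigr => e _.
  by rewrite -mulrDr subrK.
have D0 : 0 <= D q.+1.
  have b0 : grid (2 ^ q.+1) d by apply: finfun => i; exists 0%N; rewrite expn_gt0.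
  by apply: le_trans (GD q.+1 b0 ltqp).
apply: le_trans (ler_normD _ _) _; rewrite -natr1 addrC !mulrDl.
apply: lerD.
  apply: le_trans (IHq (ltnW ltqp) _) _.
  (* The contraction of the total variation under averaging exactly offsets the growth from [D q.+1]
     to [D q], so every scale costs the same and their number [p] becomes a factor. *)
  have -> : q%:R * 2 ^+ d.+1 * D q.+1 * total_variation v =
     q%:R * 2 ^+ d.+1 * D q * (2 / 2 ^+ d * total_variation v).
    rewrite !mulrA -[_ * D q * 2]mulrA Dq mulrA mulfK //.
    by rewrite expf_neq0 // pnatr_eq0.
  apply: ler_wpM2l (total_variation_average _).
  have : 0 <= D q * 2 by rewrite Dq mulr_ge0 ?exprn_ge0.
  by rewrite pmulr_lge0 // => ?; rewrite !mulr_ge0 ?exprn_ge0.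
rewrite mul1r [_ * D _]mulrC -mulrA.
apply: le_trans (_ : D q.+1 * \sum_c \sum_e `|v (child c e) - average v c| <= _); last first.
  by rewrite ler_wpM2l // sum_dist_average.
rewrite mulr_sumr; apply: le_trans (ler_norm_sum _ _ _) _; apply: ler_sum => c _.
rewrite mulr_sumr; apply: le_trans (ler_norm_sum _ _ _) _; apply: ler_sum => e _.
by rewrite normrM ler_wpM2r // GD.
Qed.

(** * Touching cells and the boundary of a set of cells *)

Definition touching (m d : nat) (b b' : grid m d) : bool :=
  [forall i, (b i <= (b' i).+1)%N && (b' i <= (b i).+1)%N].

Definition outer_boundary (m d : nat) (U : {set grid m d}) : {set grid m d} :=
  [set y | (y \notin U) && [exists x in U, touching x y]].

Lemma touching_shift (m d : nat) (i : 'I_d) (b : grid m d) :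
  touching b (shift i b) && touching (shift i b) b.
Proof.
have [e|] := eqVneq (shift i b) b.
  by rewrite e; apply/andP; split; apply/forallP => j; rewrite leqnSn.
rewrite shift_eq negbK => lt.
by apply/andP; split; apply/forallP => j; rewrite shiftE //; case: (j == i); lia.
Qed.

(** Each jump of the indicator is charged to its end outside [U], which lies in the outer boundary;
    in each of the [d] directions a cell is charged at most twice. *)
Lemma total_variation_indicator (R : numDomainType) (m d : nat) (U : {set grid m d}) :
  total_variation (fun b => (b \in U)%:R : R) <= 2 * d%:R * #|outer_boundary U|%:R.
Proof.
set W := outer_boundary U.
pose h b : R := (b \in W)%:R.
have sh : \sum_b h b = #|W|%:R.
  by rewrite -sum1_card natr_sum [RHS]big_mkcond /=; apply: eq_bigr => b _; rewrite /h; case: (b \in W).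
have -> : 2 * d%:R * #|W|%:R = \sum_(i < d) 2 * \sum_b h b.
  by rewrite sh sumr_const card_ord -[RHS]mulr_natl; ring.
apply: ler_sum => i _; rewrite mulr_natl mulr2n.
apply: (@le_trans _ _ (\sum_b (h b + if shift i b != b then h (shift i b) else 0))).
  apply: ler_sum => b _.
  have h0 b' : 0 <= if shift i b' != b' then h (shift i b') else 0.
    by case: ifP => // _; exact: ler0n.
  have [e|ne] := eqVneq (shift i b) b; first by rewrite e subrr normr0 addr0 /h.
  have /andP[a1 a2] := touching_shift i b.
  rewrite /= /h !inE; case bU: (b \in U); case sU: (shift i b \in U) => /=.
  - by rewrite subrr normr0 addr0.
  - have -> : [exists x in U, touching x (shift i b)] by apply/existsP; exists b; rewrite bU.
    by rewrite subr0 normr1 add0r.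
  - have -> : [exists x in U, touching x b] by apply/existsP; exists (shift i b); rewrite sU.
    by rewrite sub0r normrN normr1 addr0.
  - by rewrite subrr normr0 addr_ge0.
rewrite big_split /= lerD2l -big_mkcond; apply: sum_shift_le => b; exact: ler0n.
Qed.

(** * Cells, boxes and the matching *)

Lemma cell_lt (K q : nat) (x : 'I_K) : (x * 2 ^ q %/ K < 2 ^ q)%N.
Proof.
case: x => x ltxK /=; have K0 : (0 < K)%N by case: K ltxK.
by rewrite ltn_divLR // mulnC ltn_pmul2l ?expn_gt0.
Qed.

(** Rounding down requires no divisibility, keeps successive levels nested, and indexes the cells of
    grids of different sizes by one type. *)
Definition cell (K d q : nat) (x : grid K d) : grid (2 ^ q) d :=
  [ffun i => Ordinal (cell_lt q (x i))].

Definition box (K d q : nat) (b : grid (2 ^ q) d) : {set grid K d} :=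
  [set x | cell q x == b].

Lemma parent_cell (K d q : nat) (x : grid K d) : parent (cell q.+1 x) = cell q x.
Proof.
apply/ffunP => i; apply: val_inj; rewrite /= !ffunE /=.
by rewrite -divn2 -divnMA expnS mulnCA [(K * 2)%N]mulnC divnMl.
Qed.

Lemma card_box_child (K d q : nat) (S : {set grid K d}) (c : grid (2 ^ q) d) :
  #|S :&: box K c| = (\sum_e #|S :&: box K (child c e)|)%N.
Proof.
(* Within a cell of level [q], the parities of the coordinates at level [q.+1] single out the
   child. *)
rewrite -sum1_card (partition_big (fun x => [ffun i => odd (cell q.+1 x i)]) predT) //=.
apply: eq_bigr => e _; rewrite sum1_card; apply: eq_card => x.
rewrite !inE unfold_in /= !inE -andbA; congr (_ && _).
rewrite -parent_cell; move: (cell q.+1 x) => y.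
apply/andP/eqP => [[/eqP <- /eqP <-]|->].
  by apply/ffunP => i; apply: val_inj; rewrite /= childE !ffunE /= odd_double_half.
split; apply/eqP/ffunP => i; rewrite !ffunE /=.
  by apply: val_inj; rewrite /= half_bit_double.
by rewrite oddD odd_double addbF; case: (e i).
Qed.

(** A one-dimensional cell is an integer interval between the ceilings of two consecutive multiples
    of [K / 2 ^ q], so its size is within one of [K / 2 ^ q]. *)
Lemma card_cell1 (K q : nat) (b : 'I_(2 ^ q)) (c := #|[set x : 'I_K | (x * 2 ^ q %/ K)%N == b]|) :
  (K < (c + 1) * 2 ^ q)%N /\ (c * 2 ^ q < K + 2 ^ q)%N.
Proof.
case: b @c => b ltb /=; set R := (2 ^ q)%N in ltb *; set c := #|_|.
have R0 : (0 < R)%N by rewrite expn_gt0.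
have [K0|K0] := posnP K.
  have -> : c = 0%N by apply: eq_card0 => -[x ltx]; exfalso; move: ltx; rewrite K0.
  by rewrite K0; lia.
(* [up X] is the ceiling of [X / R], and [upP] its adjunction with multiplication by [R]. *)
pose up X := ((X + R.-1) %/ R)%N.
have upP X x : (X <= x * R)%N = (up X <= x)%N.
  rewrite /up -[(up X <= x)%N]ltnS ltn_divLR // mulSn; lia.
have upl X : (X <= up X * R)%N by rewrite upP.
have upu X : (up X * R < X + R)%N by rewrite /up; have := leq_divM (X + R.-1) R; lia.
have cE : c = (up (b.+1 * K) - up (b * K))%N.
  rewrite -[RHS]muln1 -sum_nat_const_nat.
  have leK : (up (b.+1 * K) <= K)%N by rewrite -upP mulnC leq_mul2l ltb orbT.
  rewrite (big_nat_widen _ _ K) // (big_nat_widenl _ 0%N) // big_mkord sum1_card.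
  apply: eq_card => x; rewrite inE unfold_in /= -upP ltnNge -upP -ltnNge.
  by rewrite eqn_leq -ltnS ltn_divLR // leq_divRL // andbC.
have := upl (b * K)%N; have := upu (b * K)%N; have := upl (b.+1 * K)%N.
have := upu (b.+1 * K)%N.
move: (up (b.+1 * K)%N) (up (b * K)%N) cE => h l -> h1 h2 h3 h4.
have lelh : (l <= h)%N.
  by rewrite -ltnS -(ltn_pmul2r R0) mulSn; move: h3 h2; rewrite mulSn; lia.
rewrite mulnDl mulnBl mul1n; move: h1 h2; rewrite mulSn.
have := leq_mul lelh (leqnn R); lia.
Qed.

Lemma card_box (K d q : nat) (b : grid (2 ^ q) d) :
  #|box K b| = (\prod_(i < d) #|[set x : 'I_K | (x * 2 ^ q %/ K)%N == b i]|)%N.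
Proof.
rewrite -(@cardsXn 'I_d (fun=> 'I_K)); apply: eq_card => x.
rewrite !inE; apply/eqP/forallP => [<- i|h]; first by rewrite !inE ffunE.
by apply/ffunP => i; apply: val_inj; have := h i; rewrite !inE ffunE => /eqP.
Qed.

(** The factors are exchanged one at a time. The extra [M] on the left avoids an exponent [d.-1] on
    the right. *)
Lemma prod_dist_le (R : realDomainType) (d : nat) (u v : 'I_d -> R) (M e : R) :
  (forall i, `|u i| <= M) -> (forall i, `|v i| <= M) -> (forall i, `|u i - v i| <= e) ->
  `|\prod_i u i - \prod_i v i| * M <= d%:R * e * M ^+ d.
Proof.
elim: d u v => [|d IH] u v uM vM uv.
  by rewrite !big_ord0 subrr normr0 !mul0r.
have M0 : 0 <= M by apply: le_trans (uM ord0).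
rewrite !big_ord_recl; set U := \prod_(i < d) _; set V := \prod_(i < d) _.
have -> : u ord0 * U - v ord0 * V = (u ord0 - v ord0) * U + v ord0 * (U - V) by ring.
have leU : `|U| <= M ^+ d.
  rewrite normr_prod -[X in _ ^+ X]card_ord -prodr_const.
  by apply: ler_prod => i _; rewrite normr_ge0 uM.
have {}IH := IH _ _ (fun i => uM (lift ord0 i)) (fun i => vM (lift ord0 i)) (fun i => uv (lift ord0 i)).
apply: (@le_trans _ _ ((e * M ^+ d + M * `|U - V|) * M)).
  apply: ler_wpM2r => //; apply: le_trans (ler_normD _ _) _; rewrite !normrM.
  by apply: lerD; [exact: ler_pM|exact: ler_wpM2r].
have := ler_wpM2l M0 IH; rewrite -/U -/V -natr1 exprS; nra.
Qed.

(** * Number of grid points in a box, and its rounding error *)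

Section box_estimates.
Variables (R : realFieldType) (n d q : nat).
Hypothesis (leqn : (2 ^ q <= n)%N).
Let s : R := n%:R / (2 ^ q)%:R.

Let q0 : (0 : R) < (2 ^ q)%:R. Proof. by rewrite ltr0n expn_gt0. Qed.
Let n0 : (0 < n)%N. Proof. by apply: leq_trans leqn; rewrite expn_gt0. Qed.

Lemma cell_side_ge1 : 1 <= s.
Proof. by rewrite ler_pdivlMr // mul1r ler_nat. Qed.

Lemma cell1_rescaled (K : nat) (b : 'I_(2 ^ q)) : (n <= K)%N ->
  `|n%:R / K%:R * #|[set x : 'I_K | (x * 2 ^ q %/ K)%N == b]|%:R - s| <= 1.
Proof.
move=> lenK; have [] := card_cell1 K b; set c := #|_| => h1 h2.
have K0 : (0 : R) < K%:R by rewrite ltr0n (leq_trans n0).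
have nK : n%:R / K%:R <= 1 :> R by rewrite ler_pdivrMr // mul1r ler_nat.
have -> : n%:R / K%:R * c%:R - s = n%:R / K%:R * (c%:R - K%:R / (2 ^ q)%:R).
  by rewrite /s; field; rewrite ?gt_eqF.
rewrite normrM ger0_norm ?divr_ge0 // -[leRHS]mul1r; apply: ler_pM => //.
  by rewrite divr_ge0.
move: h1 h2; rewrite -(ltr_nat R) natrM natrD => h1.
rewrite -(ltr_nat R) natrM natrD => h2.
by rewrite ler_distl lerBlDr ler_pdivrMr // ltW //= -lerBlDr ler_pdivlMr // mulrBl mul1r lerBlDr ltW.
Qed.

(** The left side is the mean number of points that a uniform [n ^ d]-subset of the source grid has
    in the box; for [K = n] it is the exact count in the target. *)
Lemma box_mean_prod (K : nat) (b : grid (2 ^ q) d) : (n <= K)%N ->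
  n%:R ^+ d / K%:R ^+ d * #|box K b|%:R =
  \prod_(i < d) (n%:R / K%:R * #|[set x : 'I_K | (x * 2 ^ q %/ K)%N == b i]|%:R) :> R.
Proof.
by move=> lenK; rewrite card_box natr_prod -expr_div_n big_split /= prodr_const card_ord.
Qed.

Lemma cell1_le (K : nat) (b : 'I_(2 ^ q)) : (n <= K)%N ->
  n%:R / K%:R * #|[set x : 'I_K | (x * 2 ^ q %/ K)%N == b]|%:R <= 2 * s.
Proof.
move=> lenK; have := cell1_rescaled b lenK; have := cell_side_ge1.
rewrite ler_norml => h1 /andP[h2 h3]; lra.
Qed.

Lemma cell1_ge0 (K : nat) (b : 'I_(2 ^ q)) :
  0 <= n%:R / K%:R * #|[set x : 'I_K | (x * 2 ^ q %/ K)%N == b]|%:R :> R.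
Proof. by rewrite mulr_ge0 // divr_ge0. Qed.

Lemma box_mean_le (K : nat) (b : grid (2 ^ q) d) : (n <= K)%N ->
  n%:R ^+ d / K%:R ^+ d * #|box K b|%:R <= (2 * s) ^+ d.
Proof.
move=> lenK; rewrite box_mean_prod // -[X in _ ^+ X]card_ord -prodr_const.
by apply: ler_prod => i _; rewrite cell1_ge0 cell1_le.
Qed.

(** Both counts are products of [d] factors within 1 of [s], hence within 2 of each other and at
    most [2 * s], as [prod_dist_le] requires. *)
Lemma box_mean_dist (K : nat) (b : grid (2 ^ q) d) : (n <= K)%N ->
  `|n%:R ^+ d / K%:R ^+ d * #|box K b|%:R - #|box n b|%:R| * s <= d%:R * 2 ^+ d * s ^+ d.
Proof.
move=> lenK.
have -> : #|box n b|%:R = n%:R ^+ d / n%:R ^+ d * #|box n b|%:R :> R.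
  by rewrite divff ?mul1r // expf_neq0 // pnatr_eq0 -lt0n.
rewrite !box_mean_prod //.
pose u m (i : 'I_d) : R :=
  n%:R / m%:R * #|[set x : 'I_m | (x * 2 ^ q %/ m)%N == b i]|%:R.
rewrite -[\prod_(i < d) _]/(\prod_i u K i) -[X in _ - X]/(\prod_i u n i).
have := @prod_dist_le R d (u K) (u n) (2 * s) 2; rewrite exprMn => H.
have {H} : `|\prod_i u K i - \prod_i u n i| * (2 * s) <= d%:R * 2 * (2 ^+ d * s ^+ d).
  apply: H => i.
  - by rewrite ger0_norm ?cell1_ge0 // cell1_le.
  - by rewrite ger0_norm ?cell1_ge0 // cell1_le.
  have h1 := cell1_rescaled (b i) lenK; have h2 := cell1_rescaled (b i) (leqnn n).
  have := ler_normB (u K i - s) (u n i - s).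
  by rewrite opprB addrA subrK /u => /le_trans; apply; lra.
by lra.
Qed.

Lemma box_target_ge (b : grid (2 ^ q) d) : 2 <= s -> (s / 2) ^+ d <= #|box n b|%:R.
Proof.
move=> s2.
have -> : #|box n b|%:R = n%:R ^+ d / n%:R ^+ d * #|box n b|%:R :> R.
  by rewrite divff ?mul1r // expf_neq0 // pnatr_eq0 -lt0n.
rewrite box_mean_prod // -[X in _ ^+ X]card_ord -prodr_const.
apply: ler_prod => i _; have := cell1_rescaled (b i) (leqnn n).
rewrite ler_norml => /andP[h1 h2]; apply/andP; split; lra.
Qed.

End box_estimates.

Lemma card_cells_in (K d q : nat) (S : {set grid K d}) (U : {set grid (2 ^ q) d}) :
  #|[set x in S | cell q x \in U]| = (\sum_(b in U) #|S :&: box K b|)%N.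
Proof.
rewrite -sum1_card (partition_big (fun x => cell q x) [in U]) /=; last first.
  by move=> x; rewrite inE => /andP[].
apply: eq_bigr => b Ub; rewrite sum1_card; apply: eq_card => x.
rewrite !inE unfold_in /= !inE -andbA; congr (_ && _).
by case: eqP => [->|]; rewrite ?Ub ?andbF.
Qed.

Lemma card_grid (m d : nat) : #|{: grid m d}| = (m ^ d)%N.
Proof. by rewrite card_ffun !card_ord. Qed.

Lemma box_level0 (K d : nat) (b : grid (2 ^ 0) d) : box K b = [set: grid K d].
Proof.
apply/setP => x; rewrite !inE; apply/eqP/ffunP => i; apply: val_inj.
by case: (cell 0 x i) (b i) => [[|//] ?] [[|//] ?].
Qed.

Lemma discrepancy_matching (R : realFieldType) (d n K p : nat) (a : R)
    (S : {set grid K d}) (s := n%:R / (2 ^ p)%:R : R) :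
  (0 < d)%N -> (n <= K)%N -> (2 ^ p <= n)%N -> #|S| = (n ^ d)%N ->
  (forall q (b : grid (2 ^ q) d), (q <= p)%N ->
    `|#|S :&: box K b|%:R - #|box n b|%:R| <= a * (n%:R / (2 ^ q)%:R) ^+ d.-1) ->
  2 <= s -> p%:R * 2 ^+ d.+1 * a * (2 * d%:R) * 2 ^+ d <= s ->
  exists2 f : grid K d -> grid n d, f @: S = [set: grid n d] &
    forall x, x \in S -> touching (cell p x) (cell p (f x)).
Proof.
move=> d0 lenK lepn cS disc s2 large.
have n0 : (0 < n)%N by apply: leq_trans lepn; rewrite expn_gt0.
pose E (x : grid K d) := [set y : grid n d | touching (cell p x) (cell p y)].
pose G q (b : grid (2 ^ q) d) : R := #|S :&: box K b|%:R - #|box n b|%:R.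
have [|f injf fE] := @hall_marriage _ _ [ffun=> Ordinal n0] E S; last first.
  exists f => [|x /fE]; last by rewrite inE.
  by apply/eqP; rewrite eqEcard subsetT cardsT card_in_imset // cS card_grid /=.
move=> A sAS; set N := \bigcup_(x in A) _.
pose U := cell p @: A; pose W := outer_boundary U.
have lA : (#|A| <= \sum_(b in U) #|S :&: box K b|)%N.
  rewrite -card_cells_in; apply: subset_leq_card; apply/subsetP => x Ax.
  by rewrite inE (subsetP sAS) // imset_f.
have dUW : [disjoint U & W].
  by apply/pred0P => y; rewrite !inE; case: (y \in U).
(* The neighbours of [A] include all target points in the cells of [U], since touching is reflexive,
   and in those of [W]. *)
have lN : (\sum_(b in U) #|box n b| + \sum_(b in W) #|box n b| <= #|N|)%N.
  rewrite -bigU //=.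
  have -> : (\sum_(b in [predU U & W]) #|box n b| =
      #|[set y in [set: grid n d] | cell p y \in U :|: W]|)%N.
    by rewrite card_cells_in; apply: eq_big => b; rewrite ?setTI // !inE.
  apply: subset_leq_card; apply/subsetP => y.
  rewrite !inE andTb => h; apply/bigcupP.
  case/orP: h => [/imsetP[x Ax e]|/andP[_ /existsP[b /andP[/imsetP[x Ax ->] h]]]].
    by exists x => //; rewrite inE e; apply/forallP => i; rewrite leqnSn.
  by exists x => //; rewrite inE.
apply: leq_trans lA (leq_trans _ lN); rewrite -(ler_nat R) natrD -lerBlDl !natr_sum -sumrB.
have -> : \sum_(b in U) (#|S :&: box K b|%:R - #|box n b|%:R) =
    \sum_b G p b * (b \in U)%:R.
  by rewrite big_mkcond; apply: eq_bigr => b _; case: (b \in U); rewrite ?mulr1 ?mulr0.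
apply: le_trans (ler_norm _) _.
have s0 : 0 < s by lra.
apply: (@le_trans _ _ (#|W|%:R * (s / 2) ^+ d)); last first.
  rewrite mulr_natl -sumr_const; apply: ler_sum => b _; exact: box_target_ge.
have D0 : 0 <= a * s ^+ d.-1.
  have b0 : grid (2 ^ p) d by apply: finfun => i; exists 0%N; rewrite expn_gt0.
  by apply: le_trans (disc p b0 _).
apply: le_trans (@multiscale_bound R d p G (fun q => a * (n%:R / (2 ^ q)%:R) ^+ d.-1) _ _ _ _ _) _.
- move=> q c; rewrite /G sumrB card_box_child natr_sum; congr (_ - _).
  by rewrite -[box n c]setTI card_box_child natr_sum; apply: eq_bigr => e _; rewrite setTI.
- move=> b; rewrite /G !box_level0 setIT cS cardsT card_grid subrr //.
- exact: disc.
- move=> q; rewrite expnSr natrM invfM mulrA [in RHS]expr_div_n -[in 2 ^+ d](prednK d0) exprS.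
  by rewrite [2 * _]mulrC !mulrA mulfVK // expf_neq0 // pnatr_eq0.
rewrite /= -/s.
apply: le_trans (ler_wpM2l _ (total_variation_indicator _ _)) _.
  by apply: mulr_ge0 => //; apply: mulr_ge0 => //; exact: exprn_ge0.
rewrite -/W [leRHS]mulrC !mulrA; apply: ler_wpM2r => //.
(* Once the common factor [s ^+ d.-1] is taken out, what remains is the hypothesis [large]. *)
rewrite [(s / 2) ^+ d]expr_div_n ler_pdivlMr ?exprn_gt0 // -[in s ^+ d](prednK d0) [s ^+ _.+1]exprSr.
have -> : p%:R * 2 ^+ d.+1 * a * s ^+ d.-1 * 2 * d%:R * 2 ^+ d =
  s ^+ d.-1 * (p%:R * 2 ^+ d.+1 * a * (2 * d%:R) * 2 ^+ d) by ring.
by rewrite ler_wpM2l // exprn_ge0 // ltW.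
Qed.

(** Measured in cell sides, each point lies in the unit interval above its cell index; indices that
    differ by at most one leave the points within 2. *)
Lemma touching_cell_dist (R : realFieldType) (d n K p : nat) (x : grid K d) (y : grid n d) i :
  (0 < n)%N -> touching (cell p x) (cell p y) ->
  `|(y i)%:R - n%:R / K%:R * (x i)%:R| <= 2 * (n%:R / (2 ^ p)%:R) :> R.
Proof.
move=> n0 /forallP /(_ i); rewrite !ffunE /=.
have K0 : (0 < K)%N by case: K x => [|//] x; case: (x i).
have b2 : (0 : R) < (2 ^ p)%:R by rewrite ltr0n expn_gt0.
have floorP m (t : nat) : (0 < m)%N ->
    (t * 2 ^ p %/ m)%:R * m%:R <= t%:R * (2 ^ p)%:R :> R /\
    t%:R * (2 ^ p)%:R <= ((t * 2 ^ p %/ m)%:R + 1) * m%:R :> R.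
  move=> m0; rewrite natr1 -!natrM !ler_nat leq_divM; split=> //.
  by rewrite ltnW // ltn_ceil.
have [h1 h2] := floorP K (x i) K0; have [h3 h4] := floorP n (y i) n0.
move: (_ %/ K)%N (_ %/ n)%N h1 h2 h3 h4 => al be h1 h2 h3 h4 /andP[].
rewrite -(ler_nat R) -natr1 => h5; rewrite -(ler_nat R) -natr1 => h6.
have Kr : (0 : R) < K%:R by rewrite ltr0n.
have nr : (0 : R) < n%:R by rewrite ltr0n.
have -> : (y i)%:R - n%:R / K%:R * (x i)%:R =
  n%:R / (2 ^ p)%:R * ((y i)%:R * (2 ^ p)%:R / n%:R - (x i)%:R * (2 ^ p)%:R / K%:R) :> R.
  by field; rewrite ?gt_eqF.
rewrite normrM ger0_norm ?divr_ge0 // mulrC ler_wpM2r ?divr_ge0 //.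
move: h1 h3; rewrite -ler_pdivlMr // => h1; rewrite -ler_pdivlMr // => h3.
move: h2 h4; rewrite -ler_pdivrMr // => h2; rewrite -ler_pdivrMr // => h4.
rewrite ler_norml; apply/andP; split; lra.
Qed.

(* Imported only here: their set notations and lemma names shadow those of finset. *)
From mathcomp Require Import all_classical all_reals.
From mathcomp Require Import topology normedtype sequences exp measure.
From mathcomp Require Import ereal measurable_realfun.

(** * Lipschitz constants and tail bounds *)

Section euclidean_distance.
Variables (R : realType) (d : nat).
Implicit Types u v : 'I_d -> R.

Lemma coord_le_edist u v i : `|u i - v i| <= Defs.edist u v.
Proof.
rewrite -sqrtr_sqr ler_sqrt; last by apply: sumr_ge0 => j _; exact: sqr_ge0.
by rewrite (bigD1 i) //= lerDl sumr_ge0 // => j _; exact: sqr_ge0.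
Qed.

Lemma edist_le u v (M : R) : 0 <= M -> (forall i, `|u i - v i| <= M) ->
  Defs.edist u v <= d%:R * M.
Proof.
move=> M0 uvM; rewrite -[leRHS]ger0_norm ?mulr_ge0 // -sqrtr_sqr ler_sqrt ?sqr_ge0 //.
apply: (@le_trans _ _ (\sum_(i < d) M ^+ 2)).
  by apply: ler_sum => i _; rewrite -real_normK ?num_real // lerXn2r ?nnegrE.
rewrite sumr_const card_ord exprMn -[_ *+ d]mulr_natl ler_wpM2r ?sqr_ge0 //.
by rewrite -natrX ler_nat; case: d => // k; rewrite leq_pmulr.
Qed.

End euclidean_distance.

Lemma edist_emb_ge1 (R : realType) (m d : nat) (x y : grid m d) :
  y != x -> 1 <= Defs.edist (emb R x) (emb R y).
Proof.
move=> neyx; have [i xyi] : exists i, x i != y i.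
  by apply/existsP; rewrite -negb_forall; apply: contra neyx => /forallP h;
     apply/eqP/ffunP => i; have /eqP -> := h i.
apply: le_trans (coord_le_edist _ _ i).
rewrite /emb opprD addrACA subrr addr0.
have : (x i : nat) != y i by [].
case: (ltngtP (x i) (y i)) => // lt _.
  by rewrite distrC ger0_norm ?subr_ge0 ?ler_nat 1?ltnW // lerBrDr nat1r ler_nat.
by rewrite ger0_norm ?subr_ge0 ?ler_nat 1?ltnW // lerBrDr nat1r ler_nat.
Qed.

(** In each coordinate [f] is within [2 * s] of the rescaling by [n / K <= 1], which contracts. The
    additive error [4 * s] becomes multiplicative because distinct grid points are at distance at
    least 1. *)
Lemma Fn_le_cell_side (R : realType) (d n K p : nat) (S : {set grid K d})
    (f : grid K d -> grid n d) (s := n%:R / (2 ^ p)%:R : R) :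
  (0 < n)%N -> (n <= K)%N -> (f @: S)%SET = finset.setTfor (grid n d) ->
  (forall x, x \in S -> touching (cell p x) (cell p (f x))) ->
  Fn R n S <= d%:R * (1 + 4 * s).
Proof.
move=> n0 lenK fS adj.
have s0 : 0 <= s by rewrite divr_ge0.
have L0 : 0 <= d%:R * (1 + 4 * s) by rewrite mulr_ge0 // addr_ge0 // mulr_ge0.
have lip : LipOn R S f <= d%:R * (1 + 4 * s).
  apply: bigmax_le => // x Sx; apply: bigmax_le => // y /andP[Sy neyx].
  have e1 := edist_emb_ge1 R neyx; set e := Defs.edist _ _ in e1 *.
  have e0 : 0 < e by exact: lt_le_trans e1.
  rewrite ler_pdivrMr // -mulrA; apply: edist_le => [|i].
    by rewrite mulr_ge0 ?(ltW e0) // addr_ge0 // mulr_ge0.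
  have hx := touching_cell_dist R i n0 (adj x Sx).
  have hy := touching_cell_dist R i n0 (adj y Sy).
  have hxy : `|(x i)%:R - (y i)%:R| <= e.
    have := coord_le_edist (emb R x) (emb R y) i.
    by rewrite /emb opprD addrACA subrr addr0.
  have nK1 : n%:R / K%:R <= 1 :> R.
    by rewrite ler_pdivrMr ?ltr0n ?(leq_trans n0) // mul1r ler_nat.
  have nK0 : 0 <= n%:R / K%:R :> R by rewrite divr_ge0.
  have -> : emb R (f x) i - emb R (f y) i =
    ((f x i)%:R - n%:R / K%:R * (x i)%:R) - ((f y i)%:R - n%:R / K%:R * (y i)%:R)
     + n%:R / K%:R * ((x i)%:R - (y i)%:R) by rewrite /emb; ring.
  apply: le_trans (ler_normD _ _) _; apply: le_trans (lerD (ler_normB _ _) (lexx _)) _.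
  rewrite normrM (ger0_norm nK0).
  have h3 : n%:R / K%:R * `|(x i)%:R - (y i)%:R| <= 1 * e by apply: ler_pM.
  have : 4 * s * 1 <= 4 * s * e by rewrite ler_wpM2l // mulr_ge0.
  move: hx hy h3; rewrite -/s; lra.
apply: le_trans lip; apply: ge_inf; last by exists f.
(* [ge_inf] asks for a lower bound of the set of Lipschitz constants; 0 is one. *)
exists 0 => _ [g _ <-]; rewrite /LipOn.
elim/big_ind : _ => // [a b a0 b0|x _]; first by rewrite le_max a0.
elim/big_ind : _ => // [a b a0 b0|y _]; first by rewrite le_max a0.
by rewrite divr_ge0 // sqrtr_ge0.
Qed.

(** * Chernoff bounds for the hypergeometric law *)

Section hypergeometric_tails.
Variables (R : realType) (X : finType) (N : nat) (B : {set X}).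
Hypotheses (leNX : (N <= #|X|)%N) (X0 : (0 < #|X|)%N).
Let mu : R := N%:R / #|X|%:R * #|B|%:R.
Variables (la de : R).
Hypotheses (la0 : 0 <= la) (la2 : la <= 2^-1).

Let markov (P : pred {set X}) (h : {set X} -> R) (w M : R) : 0 < w ->
  (forall S, 0 <= h S) -> (forall S : {set X}, #|S| = N -> P S -> w <= h S) ->
  \sum_(S : {set X} | #|S| == N) h S <= M ->
  #|[set S : {set X} | (#|S| == N) && P S]|%:R <= M / w.
Proof.
move=> w0 h0 wh hM; rewrite ler_pdivlMr //; apply: le_trans hM.
rewrite mulr_natl -sumr_const big_mkcond [leRHS]big_mkcond; apply: ler_sum => S _.
rewrite inE; case: eqP => //= cS; case: ifP => // PS; exact: wh.
Qed.

(** Exponential Markov inequality with [z = expR la]. For [la <= 2^-1], the bound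
    [expR la <= (1 - la)^-1] controls [expR la - 1] by [la + 2 * la ^+ 2]. *)
Lemma hypergeometric_upper_tail :
  #|[set S : {set X} | (#|S| == N) && (mu + de <= #|S :&: B|%:R)]|%:R
  <= 'C(#|X|, N)%:R * expR (2 * la ^+ 2 * mu - la * de).
Proof.
have mu0 : 0 <= mu by rewrite mulr_ge0 // divr_ge0.
have expla : expR la - 1 <= la + 2 * la ^+ 2.
  have h : 1 - la <= expR (- la) by exact: expR_ge1Dx.
  have l1 : 0 < 1 - la by move: la2; lra.
  have : expR la <= (1 - la)^-1 by rewrite -[expR la]invrK -expRN lef_pV2 ?posrE ?expR_gt0.
  move/le_trans => /(_ (1 + la + 2 * la ^+ 2)) h2; rewrite lerBlDl addrA h2 //.
  have h3 : 0 <= la ^+ 2 * (1 - 2 * la) by rewrite mulr_ge0 ?sqr_ge0 //; move: la2; lra.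
  by rewrite -[leLHS]mul1r ler_pdivrMr //; lra.
apply: le_trans (markov (h := fun S => expR la ^+ #|S :&: B|) (w := expR (la * (mu + de)))
   (M := 'C(#|X|, N)%:R * expR (2 * la ^+ 2 * mu + la * mu)) _ _ _ _) _.
- exact: expR_gt0.
- by move=> S; rewrite exprn_ge0 // expR_ge0.
- by move=> S _ h; rewrite -expRM_natr ler_expR ler_wpM2l.
- apply: le_trans (hypergeometric_mgf B leNX _) _; first by rewrite -expR0 ler_expR.
  rewrite ler_wpM2l //; apply: le_trans (_ : expR ((expR la - 1) * (N%:R / #|X|%:R)) ^+ #|B| <= _).
    rewrite lerXn2r ?nnegrE ?expR_ge0 ?expR_ge1Dx //.
    by rewrite addr_ge0 // mulr_ge0 ?divr_ge0 // subr_ge0 -expR0 ler_expR.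
  rewrite -expRM_natr ler_expR -mulrA -/mu -mulrDl [2 * _ + la]addrC.
  exact: ler_wpM2r.
- by rewrite -mulrA -expRB ler_wpM2l // ler_expR; lra.
Qed.

(** The moment bound asks for [1 <= z], so it is applied to the complement of [S]: few points of [S]
    in [B] means many points of the complement there. *)
Lemma hypergeometric_lower_tail :
  #|[set S : {set X} | (#|S| == N) && (#|S :&: B|%:R <= mu - de)]|%:R
  <= 'C(#|X|, N)%:R * expR (2 * la ^+ 2 * mu - la * de).
Proof.
have mu0 : 0 <= mu by rewrite mulr_ge0 // divr_ge0.
have Xr : (0 : R) < #|X|%:R by rewrite ltr0n.
set r : R := N%:R / #|X|%:R.
have r0 : 0 <= r by rewrite divr_ge0.
have r1 : r <= 1 by rewrite ler_pdivrMr // mul1r ler_nat.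
have expla : la - la ^+ 2 <= 1 - expR (- la).
  have h : 1 + la <= expR la by exact: expR_ge1Dx.
  have l1 : 0 < 1 + la by rewrite ltr_wpDr.
  have : expR (- la) <= (1 + la)^-1 by rewrite expRN lef_pV2 ?posrE ?expR_gt0.
  have : (1 + la)^-1 <= 1 - la + la ^+ 2.
    have h3 : 0 <= la * la ^+ 2 by rewrite mulr_ge0 ?sqr_ge0.
    by rewrite -[leLHS]mul1r ler_pdivrMr //; lra.
  lra.
apply: le_trans (markov (h := fun S => expR la ^+ #|~: S :&: B|)
   (w := expR (la * (#|B|%:R - mu + de)))
   (M := 'C(#|X|, N)%:R * expR (la * #|B|%:R - (la - la ^+ 2) * mu)) _ _ _ _) _.
- exact: expR_gt0.
- by move=> S; rewrite exprn_ge0 // expR_ge0.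
- move=> S _ h; rewrite -expRM_natr ler_expR ler_wpM2l //.
  have : (#|S :&: B| + #|~: S :&: B| = #|B|)%N.
    by rewrite ![_ :&: B]finset.setIC -finset.setDE cardsID.
  by move=> /(congr1 (fun n => n%:R : R)); rewrite natrD; lra.
- have -> : \sum_(S : {set X} | #|S| == N) expR la ^+ #|~: S :&: B| =
     \sum_(S : {set X} | #|S| == (#|X| - N)%N) expR la ^+ #|S :&: B|.
    rewrite (reindex_inj (inv_inj (@finset.setCK X))) /=; apply: eq_big => [S|S _]; last by rewrite finset.setCK.
    rewrite cardsCs finset.setCK; have h : (#|S| <= #|X|)%N := max_card _.
    by move: leNX h; move: #|S| #|X| => a b *; apply/eqP/eqP; lia.
  apply: le_trans (hypergeometric_mgf B (leq_subr _ _) _) _; first by rewrite -expR0 ler_expR.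
  rewrite bin_sub // ler_wpM2l //.
  have -> : (#|X| - N)%:R / #|X|%:R = 1 - r :> R.
    by rewrite natrB // mulrBl divff // gt_eqF.
  (* Factoring out [expR la] recovers the moment factor of [S] itself at the negative parameter
     [- la]. *)
  have -> : 1 + (expR la - 1) * (1 - r) = expR la * (1 - r * (1 - expR (- la))).
    by rewrite expRN; have := expR_gt0 la; move: (expR la) => z z0; field; rewrite gt_eqF.
  have e1 : expR (- la) <= 1 by rewrite -expR0 ler_expR oppr_le0.
  have e0 : 0 <= expR (- la) by exact: expR_ge0.
  rewrite exprMn -expRM_natr expRD ler_wpM2l ?expR_ge0 //.
  apply: le_trans (_ : expR (- (r * (1 - expR (- la)))) ^+ #|B| <= _).
    rewrite lerXn2r ?nnegrE ?expR_ge0 ?expR_ge1Dx //.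
    by rewrite subr_ge0; nra.
  rewrite -expRM_natr ler_expR -[mu]/(r * _) mulNr lerN2 mulrA.
  by rewrite ler_wpM2r // mulrC ler_wpM2l.
- rewrite -mulrA -expRB ler_wpM2l // ler_expR.
  have := mulr_ge0 (sqr_ge0 la) mu0; lra.
Qed.

End hypergeometric_tails.

(** Take [la = s^-1], at most [2^-1]. As [mu <= (2 * s) ^+ d], the exponent is at most
    [2 ^+ d.+1 - (2 ^+ d.+1 + 1) = - 1] times [s ^+ (d - 2)], hence at most [- s ^+ 2] because [d]
    is at least 4. *)
Lemma hypergeometric_box_tail (R : realType) (X : finType) (N d : nat) (B : {set X})
    (s : R) (mu := N%:R / #|X|%:R * #|B|%:R : R) :
  (N <= #|X|)%N -> (0 < #|X|)%N -> (4 <= d)%N -> 2 <= s -> mu <= (2 * s) ^+ d ->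
  #|[set S : {set X} | (#|S| == N) &&
      ~~ (`|#|S :&: B|%:R - mu| <= (2 ^+ d.+1 + 1) * s ^+ d.-1)]|%:R
  <= 2 * 'C(#|X|, N)%:R * expR (- s ^+ 2).
Proof.
move=> leNX X0 d4 s2 lemu; set de := _ * s ^+ _.
have s0 : 0 < s by lra.
have la0 : 0 <= s^-1 by rewrite invr_ge0 ltW.
have la2 : s^-1 <= 2^-1 by rewrite lef_pV2 ?posrE.
have expo : expR (2 * s^-1 ^+ 2 * mu - s^-1 * de) <= expR (- s ^+ 2).
  rewrite ler_expR; case: d d4 @de lemu => [|[|[|[|k]]]] // _ /= lemu.
  have h : 2 * s^-1 ^+ 2 * mu <= 2 * s^-1 ^+ 2 * (2 * s) ^+ k.+4.
    by rewrite ler_wpM2l // mulr_ge0 // exprn_ge0.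
  apply: le_trans (lerB h (lexx _)) _.
  have -> : 2 * s^-1 ^+ 2 * (2 * s) ^+ k.+4 - s^-1 * ((2 ^+ k.+4.+1 + 1) * s ^+ k.+3) = - (s ^+ 2 * s ^+ k).
    rewrite exprMn !exprS; field; rewrite gt_eqF //.
  rewrite lerN2 ler_peMr ?sqr_ge0 // exprn_ege1 //; lra.
apply: (@le_trans _ _ (#|[set S : {set X} | (#|S| == N) && (mu + de <= #|S :&: B|%:R)]|%:R +
    #|[set S : {set X} | (#|S| == N) && (#|S :&: B|%:R <= mu - de)]|%:R)).
  rewrite -natrD ler_nat; apply: leq_trans (leq_card_setU _ _).
  apply: subset_leq_card; apply/fintype.subsetP => S; rewrite !inE => /andP[-> /=].
  rewrite ler_distl negb_and -!ltNge => /orP[] /ltW h; apply/orP; [right|left] => //.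
have := hypergeometric_upper_tail B leNX de la0 la2.
have := hypergeometric_lower_tail B leNX X0 de la0 la2.
have := ler_wpM2l (ler0n R 'C(#|X|, N)) expo.
rewrite -/mu; lra.
Qed.

(** Union bound over at most [n] levels, since [p < 2 ^ p <= n], and at most [n ^ d] boxes in each.
    Coarser boxes have larger sides, so the tail at level [p] is the worst. *)
Lemma discrepancy_rare (R : realType) (d n K p : nat) (s := n%:R / (2 ^ p)%:R : R) :
  (4 <= d)%N -> (n <= K)%N -> (2 ^ p <= n)%N -> 2 <= s ->
  #|[set S : {set grid K d} | (#|S| == (n ^ d)%N) &&
     [exists q : 'I_p.+1, exists b : grid (2 ^ q) d,
       ~~ (`|#|S :&: box K b|%:R - n%:R ^+ d / K%:R ^+ d * #|box K b|%:R|
            <= (2 ^+ d.+1 + 1) * (n%:R / (2 ^ q)%:R : R) ^+ d.-1)]]|%:R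
  <= 2 * n%:R ^+ d.+1 * 'C(K ^ d, n ^ d)%:R * expR (- s ^+ 2).
Proof.
move=> d4 lenK lepn s2.
have n0 : (0 < n)%N by apply: leq_trans lepn; rewrite expn_gt0.
set C : R := 'C(_, _)%:R.
pose bad q (b : grid (2 ^ q) d) : {set {set grid K d}} :=
  [set S : {set grid K d} | (#|S| == (n ^ d)%N) &&
     ~~ (`|#|S :&: box K b|%:R - n%:R ^+ d / K%:R ^+ d * #|box K b|%:R|
            <= (2 ^+ d.+1 + 1) * (n%:R / (2 ^ q)%:R : R) ^+ d.-1)].
have bad_le (q : 'I_p.+1) (b : grid (2 ^ q) d) : #|bad q b|%:R <= 2 * C * expR (- s ^+ 2).
  have leqp : (2 ^ q <= 2 ^ p)%N by rewrite leq_exp2l // -ltnS.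
  have sq : s <= n%:R / (2 ^ q)%:R.
    by rewrite ler_wpM2l // lef_pV2 ?posrE ?ltr0n ?expn_gt0 // ler_nat.
  have := @hypergeometric_box_tail R _ (n ^ d) d (box K b) (n%:R / (2 ^ q)%:R).
  rewrite card_grid leq_exp2r ?(leq_trans _ d4) // lenK expn_gt0 (leq_trans n0 lenK).
  rewrite (le_trans s2 sq) [(n ^ d)%:R]natrX [(K ^ d)%:R]natrX.
  cbv zeta; rewrite box_mean_le ?(leq_trans leqp lepn) // => H.
  apply: le_trans (H isT isT isT isT isT) _.
  have s0 : 0 <= s by lra.
  rewrite ler_wpM2l ?mulr_ge0 // ler_expR lerN2.
  by apply: lerXn2r => //; rewrite nnegrE // (le_trans s0).
apply: (@le_trans _ _ (\sum_(q < p.+1) \sum_(b : grid (2 ^ q) d) #|bad q b|%:R)).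
  under eq_bigr => q _ do rewrite -natr_sum.
  rewrite -natr_sum ler_nat.
  apply: leq_trans (_ : #|\bigcup_(q < p.+1) \bigcup_(b : grid (2 ^ q) d) bad q b| <= _)%N.
    apply: subset_leq_card; apply/fintype.subsetP => S; rewrite inE => /andP[cS /existsP[q /existsP[b h]]].
    apply/finset.bigcupP; exists q => //; apply/finset.bigcupP; exists b => //.
    by rewrite inE cS.
  have card_bigcup (I : finType) (F : I -> {set {set grid K d}}) :
      (#|\bigcup_i F i| <= \sum_i #|F i|)%N.
    elim/big_rec2 : _ => [|i m U _ leU]; first by rewrite cards0.
    by apply: leq_trans (leq_card_setU _ _) _; rewrite leq_add2l.
  apply: leq_trans (card_bigcup _ _) _; apply: leq_sum => q _; exact: card_bigcup.
apply: (@le_trans _ _ (\sum_(q < p.+1) n%:R ^+ d * (2 * C * expR (- s ^+ 2)))).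
  apply: ler_sum => q _.
  apply: le_trans (ler_sum _ (fun b _ => bad_le q b)) _.
  rewrite sumr_const card_grid -[_ *+ _]mulr_natl ler_wpM2r ?mulr_ge0 ?expR_ge0 //.
  rewrite -natrX ler_nat leq_exp2r ?(leq_trans _ d4) //.
  by apply: leq_trans lepn; rewrite leq_exp2l // -ltnS.
rewrite sumr_const card_ord -[_ *+ _]mulr_natl.
have -> : 2 * n%:R ^+ d.+1 * C * expR (- s ^+ 2) =
   n%:R * (n%:R ^+ d * (2 * C * expR (- s ^+ 2))) by rewrite exprS; ring.
rewrite ler_wpM2r ?mulr_ge0 ?expR_ge0 ?exprn_ge0 // ler_nat.
by apply: leq_trans lepn; rewrite ltn_expl.
Qed.

(** The constant [a] of [discrepancy_matching] is the sum of the random part [2 ^+ d.+1 + 1] and the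
    rounding part [d%:R * 2 ^+ d]. *)
Lemma Fn_le_of_small_discrepancy (R : realType) (d n K p : nat) (S : {set grid K d})
    (s := n%:R / (2 ^ p)%:R : R) :
  (0 < d)%N -> (n <= K)%N -> (2 ^ p <= n)%N -> #|S| = (n ^ d)%N ->
  (forall q (b : grid (2 ^ q) d), (q <= p)%N ->
    `|#|S :&: box K b|%:R - n%:R ^+ d / K%:R ^+ d * #|box K b|%:R|
       <= (2 ^+ d.+1 + 1) * (n%:R / (2 ^ q)%:R : R) ^+ d.-1) ->
  2 <= s ->
  p%:R * (2 ^+ d.+1 * (2 ^+ d.+1 + 1 + d%:R * 2 ^+ d) * (2 * d%:R) * 2 ^+ d) <= s ->
  Fn R n S <= d%:R * (1 + 4 * s).
Proof.
move=> d0 lenK lepn cS disc s2 large.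
have n0 : (0 < n)%N by apply: leq_trans lepn; rewrite expn_gt0.
case: (@discrepancy_matching R d n K p (2 ^+ d.+1 + 1 + d%:R * 2 ^+ d) S
  d0 lenK lepn cS _ s2 _) => [||f fS adj].
- move=> q b leqp; have le2 : (2 ^ q <= n)%N by apply: leq_trans lepn; rewrite leq_exp2l.
  have sq := cell_side_ge1 R le2; set t := n%:R / (2 ^ q)%:R in sq *.
  have t0 : 0 < t by exact: lt_le_trans sq.
  have := box_mean_dist R le2 b lenK; rewrite -/t -[in t ^+ d](prednK d0) exprSr [d%:R * _ * (_ * t)]mulrA ler_pM2r //.
  move=> h; have := disc q b leqp; rewrite -/t => h'; rewrite mulrDl.
  apply: le_trans (lerD h' h); apply: le_trans (ler_normD _ _).
  by rewrite addrA subrK.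
- by apply: le_trans large; rewrite !mulrA.
exact: (@Fn_le_cell_side R d n K p S f).
Qed.

(** With cells of side of order [log n], failure has probability at most [1 / n ^ 2], which is
    summable, with constants independent of [K]. *)
Lemma large_Fn_rare (R : realType) (d : nat) : (4 <= d)%N ->
  exists (C : R) (n0 : nat), forall n K, (n0 <= n)%N -> (n <= K)%N ->
  #|[set S : {set grid K d} | (#|S| == (n ^ d)%N) && ~~ (Fn R n S <= C * log2 n%:R)]|%:R
     * n%:R ^+ 2 <= 'C(K ^ d, n ^ d)%:R :> R.
Proof.
(* [A] is the factor of [p] in [Fn_le_of_small_discrepancy]; being at least [d + 4], it also lets
   [expR (- s ^+ 2)] beat the union bound. *)
move=> d4; pose A := (2 ^ d.+1 * (2 ^ d.+1 + 1 + d * 2 ^ d) * (2 * d) * 2 ^ d)%N.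
have Ad : (d + 4 <= A)%N.
  have h1 : (0 < 2 ^ d)%N by rewrite expn_gt0.
  have h2 : (0 < 2 ^ d.+1 * (2 ^ d.+1 + 1 + d * 2 ^ d))%N by rewrite muln_gt0 expn_gt0 addn1.
  by rewrite /A; apply: leq_trans (leq_pmulr _ h1); apply: leq_trans (leq_pmull _ h2); lia.
have AE : 2 ^+ d.+1 * (2 ^+ d.+1 + 1 + d%:R * 2 ^+ d) * (2 * d%:R) * 2 ^+ d = A%:R :> R.
  by rewrite /A !natrM !natrD !natrM !natrX.
clearbody A; have A0 : (1 <= 4 * A)%N by lia.
(* The 16 comes from [4 * s <= 8 * A * L] and [L <= 2 * log2 n]; the threshold ensures
   [A * L <= n]. *)
exists (d%:R * (1 + 16 * A%:R)), (2 ^ (4 * A))%N => n K len0 lenK.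
have n0 : (0 < n)%N by apply: leq_trans len0; rewrite expn_gt0.
pose L := (trunc_log 2 n).+1.
have [leLn ltnL] : (2 ^ L.-1 <= n)%N /\ (n < 2 ^ L)%N.
  by rewrite /= trunc_logP // trunc_log_ltn.
have L4A : (4 * A <= L.-1)%N by rewrite /= trunc_log_max.
have ALn : (A * L <= n)%N.
  (* Square [k < 2 ^ k] for [k] the half of [L.-1], then use [2 * A <= k.+1] in one of the two
     factors. *)
  apply: leq_trans leLn; have := L4A; move: (L.-1) (prednK (ltn0Sn _) : L.-1.+1 = L) => l <- hl.
  have := ltn_expl (l./2) (ltnSn 1); have := odd_double_half l; set k := l./2 => el lk.
  apply: (@leq_trans (2 ^ (k + k))); last by rewrite leq_exp2l //; lia.
  rewrite expnD; apply: leq_trans (leq_mul lk lk); have Ak : (2 * A <= k.+1)%N by lia.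
  apply: leq_trans (leq_mul Ak (leqnn _)); rewrite [(2 * A)%N]mulnC -mulnA leq_mul2l.
  by apply/orP; right; lia.
have AL0 : (0 < A * L)%N by rewrite muln_gt0; apply/andP; split=> //; lia.
(* The finest level whose cell side is still at least [A * L]; the side is then at most
   [2 * A * L]. *)
pose p := trunc_log 2 (n %/ (A * L)).
have nAL : (0 < n %/ (A * L))%N by rewrite divn_gt0.
have lep : (2 ^ p * (A * L) <= n)%N by rewrite -leq_divRL // trunc_logP.
have gtp : (n < 2 ^ p.+1 * (A * L))%N by rewrite -ltn_divLR // trunc_log_ltn.
have lepn : (2 ^ p <= n)%N by apply: leq_trans lep; exact: leq_pmulr.
have lepL : (p <= L)%N.
  by apply: leq_trans (leqnSn _); rewrite trunc_log_max.
set s := n%:R / (2 ^ p)%:R : R.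
have P0 : (0 : R) < (2 ^ p)%:R by rewrite ltr0n expn_gt0.
have sge : A%:R * L%:R <= s by rewrite ler_pdivlMr // -!natrM ler_nat mulnC.
have slt : s <= 2 * (A%:R * L%:R).
  by rewrite ler_pdivrMr // -!natrM ler_nat ltnW //; move: gtp; rewrite expnS; lia.
have L1 : (1 : R) <= L%:R by rewrite ler1n.
have A4 : (d + 4)%:R <= A%:R :> R by rewrite ler_nat.
have A4' : (4 : R) <= A%:R by rewrite ler_nat; lia.
have s2 : 2 <= s.
  by apply: le_trans sge; apply: le_trans (_ : 2 * 1 <= _); [lra|apply: ler_pM => //; lra].
have logL : L%:R <= 2 * log2 n%:R :> R.
  have ln2 : 0 < ln 2 :> R by rewrite ln_gt0 // ltr1n.
  have : L.-1%:R <= log2 n%:R :> R.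
    rewrite /log2 ler_pdivlMr // mulr_natl -lnXn // -natrX ler_ln ?posrE ?ltr0n ?expn_gt0 //.
    by rewrite ler_nat.
  have : (1 : R) <= L.-1%:R by rewrite ler1n (leq_trans A0).
  have -> : L%:R = L.-1%:R + 1 :> R by rewrite natr1.
  lra.
have disc := discrepancy_rare d4 lenK lepn s2.
apply: le_trans (ler_wpM2r (exprn_ge0 _ _) (le_trans _ disc)) _; first exact: ler0n.
  rewrite ler_nat; apply: subset_leq_card; apply/fintype.subsetP => S; rewrite !inE => /andP[/eqP cS largeF].
  rewrite cS eqxx /=; apply: contraNT largeF => /existsPn nobad.
  apply: le_trans (_ : d%:R * (1 + 4 * s) <= _).
    apply: (@Fn_le_of_small_discrepancy _ _ _ K p) => //; first exact: leq_trans d4.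
    - move=> q b leqp; have /existsPn/(_ b) := nobad (Ordinal (leqp : (q < p.+1)%N)).
      by rewrite negbK.
    - apply: le_trans sge; rewrite mulrC.
      by rewrite AE ler_wpM2l // ler_nat.
  rewrite -mulrA ler_wpM2l // mulrDl mul1r.
  have : 8 * A%:R * L%:R <= 8 * A%:R * (2 * log2 n%:R) :> R by rewrite ler_wpM2l // mulr_ge0.
  have : (2 : R) <= L%:R by rewrite ler_nat ltnS (leq_trans A0).
  lra.
rewrite -/s; set C : R := 'C(_, _)%:R.
(* Here [n <= expR L] and [s ^+ 2 >= s >= A * L >= (d + 4) * L]. *)
have ne : n%:R ^+ (d + 4) <= expR (s ^+ 2) :> R.
  have nL : n%:R <= expR L%:R :> R.
    apply: le_trans (_ : 2 ^+ L <= _); first by rewrite -natrX ler_nat ltnW.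
    rewrite -[L%:R]mul1r expRM_natr lerXn2r ?nnegrE ?expR_ge0 //.
    by apply: le_trans (expR_ge1Dx 1).
  apply: le_trans (_ : expR (L%:R * (d + 4)%:R) <= _).
    by rewrite expRM_natr lerXn2r ?nnegrE ?expR_ge0.
  rewrite ler_expR; apply: le_trans (_ : s * 1 <= _).
    by rewrite mulr1; apply: le_trans sge; rewrite mulrC ler_wpM2r.
  by rewrite expr2 ler_wpM2l //; lra.
have n2 : (2 : R) <= n%:R.
  by rewrite ler_nat; apply: leq_trans len0; rewrite -{1}(expn1 2) leq_exp2l.
have eqn2 : 2 * n%:R ^+ d.+1 * C * n%:R ^+ 2 = C * (2 * n%:R ^+ (d + 3)) :> R.
  rewrite (_ : (d + 3)%N = (d.+1 + 2)%N) ?exprD; last by rewrite addSn -addnS.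
  by move: (n%:R ^+ d.+1) (n%:R ^+ 2) C => x y z; ring.
rewrite mulrAC eqn2 expRN ler_pdivrMr ?expR_gt0 // ler_wpM2l //; apply: le_trans ne.
by rewrite [(d + 4)%N]addnS exprS ler_wpM2r // exprn_ge0.
Qed.

(** * The product measure *)

Local Open Scope classical_set_scope.
Local Open Scope ring_scope.

(** Additivity on the constant sequence of empty sets gives a convergent series with constant
    terms. *)
Lemma additive_set0 (R : realType) (T : Type) (G : set (set T)) (P : set T -> R) :
  (forall F : nat -> set T, (forall i, <<s G >> (F i)) -> trivIset setT F ->
     (fun k : nat => \sum_(0 <= i < k) P (F i)) @ \oo --> (P (\bigcup_i F i) : R^o)) ->
  P set0 = 0.
Proof.
move=> P_additive.
have tI : trivIset setT (fun _ : nat => set0 : set T) by move=> i j _ _ [x []].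
have := P_additive _ (fun=> @sigma_algebra0 _ setT G) tI.
rewrite bigcup0 // => cvP.
have cv0 : (fun _ : nat => P set0 : R^o) @ \oo --> (0 : R^o).
  by apply: cvg_series_cvg_0; apply/cvg_ex; exists (P set0).
by have /cvg_lim := cv0; rewrite lim_cst; [apply|]; exact: norm_hausdorff.
Qed.

Section measure_of_set_function.
Variables (R : realType) (T : pointedType) (G : set (set T)) (P : set T -> R).
Hypotheses (P_ge0 : forall A, <<s G >> A -> 0 <= P A)
  (P_additive : forall F : nat -> set T, (forall i, <<s G >> (F i)) -> trivIset setT F ->
     (fun k : nat => \sum_(0 <= i < k) P (F i)) @ \oo --> (P (\bigcup_i F i) : R^o)).

(** A measure must be nonnegative on all sets, while [P] is controlled on the sigma-algebra
    alone. *)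
Definition extended_by_zero (A : set (g_sigma_algebraType G)) : \bar R :=
  if `[< <<s G >> A >] then (P A)%:E else 0%E.

Lemma extended_by_zeroE A : <<s G >> A -> extended_by_zero A = (P A)%:E.
Proof. by move=> mA; rewrite /extended_by_zero; case: asboolP. Qed.

Let ext0 : extended_by_zero set0 = 0%E.
Proof. by rewrite extended_by_zeroE ?(additive_set0 P_additive) //; exact: sigma_algebra0. Qed.

Let ext_ge0 A : (0 <= extended_by_zero A)%E.
Proof.
by rewrite /extended_by_zero; case: asboolP => // mA; rewrite lee_fin P_ge0.
Qed.

Let ext_sigma_additive : semi_sigma_additive extended_by_zero.
Proof.
move=> F mF tF mU; rewrite extended_by_zeroE //.
rewrite (_ : (fun n => _) = EFin \o (fun n => \sum_(0 <= i < n) P (F i))).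
  by apply: cvg_EFin; [exact: nearW|exact: P_additive].
apply/funext => n /=; rewrite -sumEFin; apply: eq_bigr => i _.
by rewrite extended_by_zeroE //; exact: mF.
Qed.

Lemma measure_of_set_function :
  exists mu : {measure set (g_sigma_algebraType G) -> \bar R},
    forall A, <<s G >> A -> mu A = (P A)%:E.
Proof.
pose mu : {measure set (g_sigma_algebraType G) -> \bar R} := HB.pack extended_by_zero
  (isMeasure.Build _ _ _ extended_by_zero ext0 ext_ge0 ext_sigma_additive).
by exists mu => A mA; rewrite -extended_by_zeroE.
Qed.

End measure_of_set_function.

Definition pointed_Omega (R : realType) (c : nat -> R) (d : nat) (w0 : Omega c d) : pointedType :=
  HB.pack (Omega c d) (gen_eqMixin (Omega c d)) (gen_choiceMixin (Omega c d))
    (isPointed.Build (Omega c d) w0).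

Section coordinates.
Variables (R : realType) (c : nat -> R) (d : nat).

(** The prefixes of length [n.+1] whose last entry lies in [A n]; they index the finitely many
    cylinders that make up an event on coordinate [n]. Taking [A] as a family over all indices
    avoids a cast from [Fact c d n] to [Fact c d i]. *)
Definition coordinate_sections (A : forall k, {set Fact c d k}) (n : nat) :
    {set {dffun forall i : 'I_n.+1, Fact c d i}} :=
  finset.setXn (fun i : 'I_n.+1 =>
    if (i : nat) == n then A i else finset.setTfor (Fact c d i)).

Lemma mem_coordinate_sections A n (s : {dffun forall i : 'I_n.+1, Fact c d i}) :
  (s \in coordinate_sections A n) = (s ord_max \in A n).
Proof.
apply/finset.setXnP/idP => [/(_ ord_max)|h i]; first by rewrite eqxx.
case: eqP => [e|_]; last by rewrite finset.in_setT.
by have -> : i = ord_max by exact: val_inj.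
Qed.

Lemma card_coordinate_sections A n : #|coordinate_sections A n| =
  (\prod_(i < n) #|{: Fact c d i}| * #|A n|)%N.
Proof.
rewrite finset.cardsXn big_ord_recr /= eqxx; congr (_ * _)%N.
by apply: eq_bigr => i _; rewrite ltn_eqF //; exact: cardsT.
Qed.

Lemma coordinate_eventE (A : forall k, {set Fact c d k}) n :
  [set w : Omega c d | w n \in A n] =
  \big[setU/set0]_(s <- enum (coordinate_sections A n)) cylinder (fun i : 'I_n.+1 => s i).
Proof.
rewrite -bigcup_seq; apply/seteqP; split => [w /= wA|w [s /=]].
  exists ([ffun i : 'I_n.+1 => w i] : {dffun forall i : 'I_n.+1, Fact c d i}).
    by rewrite /= mem_enum mem_coordinate_sections ffunE.
  by move=> i; rewrite /= ffunE.
by rewrite mem_enum mem_coordinate_sections => sA /(_ ord_max) /= ->.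
Qed.

Variable w0 : Omega c d.
Let T : pointedType := pointed_Omega w0.
Let G : set (set T) := @cylinders R c d.

Lemma measurable_coordinate_event (A : forall k, {set Fact c d k}) n :
  measurable ([set w | (w : Omega c d) n \in A n] : set (g_sigma_algebraType G)).
Proof.
rewrite coordinate_eventE; apply: bigsetU_measurable => s _.
by apply: sub_sigma_algebra; exists n.+1, (fun i => s i).
Qed.

(** Subadditivity over the cylinders; the number of prefixes of length [n] cancels against the first
    [n] factors of the cylinder measure. *)
Lemma coordinate_event_le (mu : {measure set (g_sigma_algebraType G) -> \bar R}) :
  (forall N (s : forall i : 'I_N, Fact c d i),
     mu (cylinder s) = (\prod_(i < N) (#|{: Fact c d i}|%:R)^-1)%:E) ->
  forall (A : forall k, {set Fact c d k}) n,
  (mu [set w | (w : Omega c d) n \in A n] <= (#|A n|%:R / #|{: Fact c d n}|%:R)%:E)%E.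
Proof.
move=> muC A n; rewrite coordinate_eventE.
apply: (@le_trans _ _ (\sum_(s <- enum (coordinate_sections A n))
    mu (cylinder (fun i : 'I_n.+1 => s i)))%E).
  elim: (enum _) => [|s r IH]; first by rewrite !big_nil measure0.
  rewrite !big_cons; apply: le_trans (leeD2l _ IH); apply: measureU2.
    by apply: sub_sigma_algebra; exists n.+1, (fun i => s i).
  apply: bigsetU_measurable => s' _.
  by apply: sub_sigma_algebra; exists n.+1, (fun i => s' i).
under eq_bigr => s _ do rewrite muC.
rewrite sumEFin lee_fin big_enum /= sumr_const card_coordinate_sections.
rewrite big_ord_recr /= -[_ *+ _]mulr_natr natrM natr_prod prodfV.
set q := \prod_(i < n) _.
have q0 : 0 <= q by apply: prodr_ge0.
have -> : q^-1 * (#|{: Fact c d n}|%:R)^-1 * (q * #|A n|%:R) =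
  (q^-1 * q) * (#|A n|%:R / #|{: Fact c d n}|%:R) by ring.
rewrite ler_piMl ?divr_ge0 //.
by have [->|qn0] := eqVneq q 0; [rewrite mulr0|rewrite mulVf].
Qed.

End coordinates.

(** * Borel-Cantelli and conclusion *)

Lemma sum_inv_sqr_le2 (R : realFieldType) (k : nat) :
  \sum_(0 <= i < k) (i%:R ^+ 2)^-1 <= 2 :> R.
Proof.
case: k => [|[|k]]; first by rewrite big_nil.
  by rewrite big_nat1 expr0n invr0.
(* The sharper bound is the one that passes through the induction; the term at [i = 0] is 0. *)
suff : \sum_(0 <= i < k.+2) (i%:R ^+ 2)^-1 <= 2 - k.+1%:R^-1 :> R.
  by move/le_trans; apply; rewrite gerBl invr_ge0.
elim: k => [|k IH].
  by rewrite big_nat_recr // big_nat1 /= expr0n invr0 expr1n invr1; lra.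
rewrite big_nat_recr //=; apply: le_trans (lerD IH (lexx _)) _.
rewrite -[k.+2%:R]natr1; set x : R := k.+1%:R; have x0 : 0 < x by rewrite ltr0n.
clearbody x; rewrite -subr_ge0 (_ : _ - _ = (x * (x + 1) ^+ 2)^-1); last first.
  by have x1 : 0 < x + 1; [lra|field; rewrite (gt_eqF x0) (gt_eqF x1)].
by rewrite invr_ge0 mulr_ge0 ?sqr_ge0 // ltW.
Qed.

Lemma limn_esup_lty (R : realType) (u : nat -> \bar R) (N : nat) (C : R) :
  (forall n, (N <= n)%N -> u n <= C%:E)%E -> (limn_esup u < +oo)%E.
Proof.
move=> uC; apply: (@le_lt_trans _ _ C%:E); last exact: ltry.
have -> : limn_esup u = ereal_inf (range (esups u)).
  by rewrite limn_esup_lim; apply/cvg_lim => //; exact: cvg_esups_inf.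
apply: le_trans (ereal_inf_lbound _) _; first by exists N.
by apply: ge_ereal_sup => _ [n /= leNn <-]; exact: uC.
Qed.

(** The base of the power is at least 1, so [1 <= c n]. *)
Lemma Kc_ge (R : realType) (c : nat -> R) (d n : nat) : (2 <= n)%N ->
  (1 + 2 ^+ (d + 5) / log2 n%:R) `^ (d%:R)^-1 <= c n -> (n <= Kc c n)%N.
Proof.
move=> n2 cn.
have log0 : 0 <= log2 n%:R :> R.
  by rewrite /log2 divr_ge0 // ln_ge0 // ler1n // (leq_trans _ n2).
have c1 : 1 <= c n.
  apply: le_trans cn; apply: (@le_trans _ _ (1 `^ (d%:R)^-1)); first by rewrite powR1.
  have x0 : 0 <= 2 ^+ (d + 5) / log2 n%:R :> R by rewrite divr_ge0 // exprn_ge0.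
  by apply: ge0_ler_powR; rewrite ?nnegrE ?invr_ge0 ?lerDl // addr_ge0.
rewrite /Kc truncn_ge_nat ?mulr_ge0 ?(le_trans _ c1) //.
by rewrite ler_peMl.
Qed.

Lemma card_Fact (R : realType) (c : nat -> R) (d n : nat) :
  #|{: Fact c d n}| = 'C(Kc c n ^ d, n ^ d).
Proof.
rewrite card_sig -(card_grid (Kc c n) d) -cardsT -cards_draws.
by apply: eq_card => A; rewrite !inE finset.subsetT.
Qed.

Lemma card_Fact_pred (R : realType) (c : nat -> R) (d n : nat)
    (Q : pred {set grid (Kc c n) d}) :
  #|[set x : Fact c d n | Q (val x)]%SET| =
  #|[set S : {set grid (Kc c n) d} | (#|S| == (n ^ d)%N) && Q S]%SET|.
Proof.
rewrite -(card_imset _ (val_inj : injective (val : Fact c d n -> _))).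
apply: eq_card => S; rewrite inE; apply/imsetP/andP => [[x]|[cS QS]].
  by rewrite inE => Qx ->; split=> //; exact: (valP x).
by exists (Sub S cS : Fact c d n) => //; rewrite inE /=.
Qed.

Theorem theorem1 (R : realType) (d : nat) (c : nat -> R) :
  (4 <= d)%N ->
  (forall n, 0 < c n) ->
  (forall n : nat, (2 <= n)%N ->
     (1 + 2 ^+ (d + 5) / log2 n%:R) `^ (d%:R)^-1 <= c n) ->
  forall P : set (Omega c d) -> R,
    product_uniform_prob P ->
    P [set w | (limn_esup (fun n => (Fw w n / log2 n%:R)%:E) < +oo)%E] = 1.
Proof.
move=> d4 _ c_ge P [P_ge0 PT P_add P_cyl].
(* An empty product would force [P setT = P set0 = 0]. *)
have [w0 _] : exists w : Omega c d, True.
  apply: contrapT => noW; have T0 : [set: Omega c d] = set0.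
    by apply/seteqP; split => w // _; apply: noW; exists w.
  by have := additive_set0 P_add; rewrite -T0 PT => /eqP; rewrite oner_eq0.
pose T := pointed_Omega w0.
have [mu muE] := @measure_of_set_function R T (@cylinders R c d) P P_ge0 P_add.
have mu_cyl N (s : forall i : 'I_N, Fact c d i) :
    mu (cylinder s) = (\prod_(i < N) (#|{: Fact c d i}|%:R)^-1)%:E.
  by rewrite -(P_cyl N s); apply: muE; apply: sub_sigma_algebra; exists N, s.
have [C [n0 rare]] := large_Fn_rare R d4.
(* Emptying the event for small [n] makes the bound [(n%:R ^+ 2)^-1] valid for every [n], even at 0
   where this inverse is 0. *)
pose bad n : {set Fact c d n} := if (maxn n0 2 <= n)%N
  then [set x : Fact c d n | ~~ (Fn R n (val x) <= C * log2 n%:R)]%SET else finset.set0.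
pose F n := [set w : Omega c d | w n \in bad n].
have mF n : measurable (F n : set (g_sigma_algebraType (@cylinders R c d : set (set T)))).
  exact: (@measurable_coordinate_event R c d w0 bad n).
have F_le n : (mu (F n) <= ((n%:R ^+ 2)^-1)%:E)%E.
  apply: le_trans (@coordinate_event_le R c d w0 mu mu_cyl bad n) _; rewrite lee_fin.
  rewrite /bad; case: ifPn => [|_]; last by rewrite cards0 mul0r invr_ge0 exprn_ge0.
  rewrite geq_max => /andP[len0 n2]; have leK := @Kc_ge R c d n n2 (c_ge n n2).
  have nn : 0 < n%:R ^+ 2 :> R by rewrite exprn_gt0 // ltr0n (leq_trans _ n2).
  rewrite (@card_Fact_pred R c d n (fun S => ~~ (Fn R n S <= C * log2 n%:R))) card_Fact.
  rewrite ler_pdivrMr ?ltr0n ?bin_gt0 ?leq_exp2r ?(leq_trans _ d4) //.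
  by rewrite [leRHS]mulrC ler_pdivlMr // rare.
have limsup0 : mu (lim_sup_set F) = 0%E.
  apply: lim_sup_set_cvg0 => //; apply: (@le_lt_trans _ _ 2%:E); last exact: ltry.
  apply: lime_le; first exact: is_cvg_nneseries.
  apply: nearW => k; apply: le_trans (_ : (\sum_(0 <= i < k) ((i%:R ^+ 2)^-1)%:E <= _)%E).
    by apply: lee_sum => i _; exact: F_le.
  by rewrite sumEFin lee_fin sum_inv_sqr_le2.
set E := [set w | _].
(* [mu] and [P] agree only on measurable sets. Each [f n] depends on coordinate [n] alone, so its
   preimages are coordinate events. *)
have mE : measurable (E : set (g_sigma_algebraType (@cylinders R c d : set (set T)))).
  pose f n (w : g_sigma_algebraType (@cylinders R c d : set (set T))) : \bar R :=
    (@Fw R c d w n / log2 n%:R)%:E.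
  have mf n : measurable_fun setT (f n).
    move=> _ Y mY; rewrite setTI.
    pose A k : {set Fact c d k} := [set x : Fact c d k | `[< Y (Fn R k (val x) / log2 k%:R)%:E >] ]%SET.
    rewrite (_ : _ @^-1` _ = [set w : Omega c d | w n \in A n]).
      exact: (@measurable_coordinate_event R c d w0 A n).
    by apply/seteqP; split => w /=; rewrite inE asboolE.
  have := @emeasurable_fun_infty_o _ _ _ setT _ measurableT (measurable_fun_limn_esup mf) +oo%E.
  by rewrite setTI.
(* A point lying in only finitely many [F n] has its ratios eventually bounded by [C]. *)
have sE : ~` E `<=` lim_sup_set F.
  move=> w nEw; apply: contrapT => nF; apply: nEw.
  have [N Nw] : exists N, forall j, (N <= j)%N -> ~ F j w.
    apply: contrapT => h; apply: nF => N _; apply: contrapT => h'; apply: h.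
    by exists N => j leNj Fj; apply: h'; exists j.
  apply: (@limn_esup_lty _ _ (maxn N (maxn n0 2)) C) => n.
  rewrite geq_max => /andP[leNn len0]; rewrite lee_fin.
  have n2 : (2 <= n)%N by move: len0; rewrite geq_max => /andP[].
  have log0 : 0 < log2 n%:R :> R by rewrite /log2 divr_gt0 // ln_gt0 // ltr1n.
  rewrite ler_pdivrMr //; apply: contrapT => /negP large; apply: (Nw n leNn).
  by rewrite /F /= /bad len0 inE.
have muC0 : mu (~` E) = 0%E.
  apply/eqP; rewrite -measure_le0 -limsup0; apply: le_measure; rewrite ?inE //.
    exact: measurableC.
  by apply: bigcap_measurable => // k _; exact: bigcup_measurable.
have : mu setT = mu E.
  transitivity (mu E + mu (~` E))%E; last by rewrite muC0 adde0.
  by rewrite -(setUv E); exact: (measureU mu mE (measurableC mE) (setICr E)).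
rewrite !muE //; last exact: (@measurableT _ (g_sigma_algebraType (@cylinders R c d : set (set T)))).
by rewrite PT => -[].
Qed.
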